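(* Let $d>2$ be an integer and set $\widetilde p_d=2-\frac{4}{2+d(2^{d}+2)}$. For every $\widetilde p_{d}< p\leq 2$ there is a constant $C=C(p,d)>0$ such that for all $N\in\mathbb{N}$ and every function $f:\mathbb{Z}\to\mathbb{R}$, $$\|A^{d}_{N}f\|_{p'}\leq C\, N^{d/p'-d/p}\|f\|_p,$$ where $A^d_N f(x)=\frac{1}{N}\sum_{k=1}^{N} f(x+k^d)$ for $x\in\mathbb{Z}$.
   Context: For $f:\mathbb{Z}\to\mathbb{R}$, $\|f\|_p$ denotes the $\ell^p(\mathbb{Z})$-norm, and $p'=\frac{p}{p-1}$ is the conjugate exponent. *)

(* Defs.v *)
From HB Require Import structures.
From mathcomp Require Import all_boot all_order all_algebra.
From mathcomp Require Import all_classical all_reals all_analysis.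
Set Implicit Arguments. Unset Strict Implicit. Unset Printing Implicit Defensive.
Import Order.TTheory GRing.Theory Num.Theory.
Local Open Scope ring_scope.
Local Open Scope classical_set_scope.

(* ell^p(Z) norm, valued in the extended reals (+oo when f is not in ell^p) *)
Definition lpnorm {R : realType} (p : R) (f : int -> R) : \bar R :=
  poweR (\esum_(x in [set: int]) ((`|f x| `^ p)%:E))%E p^-1.

Definition conj_exp {R : realType} (p : R) : R := p / (p - 1).

Definition avg_op {R : realType} (d N : nat) (f : int -> R) (x : int) : R :=
  N%:R^-1 * \sum_(1 <= k < N.+1) f (x + (k%:Z) ^+ d).

Definition ptilde {R : realType} (d : nat) : R :=
  2 - 4 / (2 + d%:R * (2 ^+ d + 2)).

(* Main.v *)
Require Import Defs.
From HB Require Import structures.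
From mathcomp Require Import all_boot all_order all_algebra.
From mathcomp Require Import all_classical all_reals all_analysis.
From mathcomp Require Import complex.
From mathcomp Require Import zify ring lra.
Set Implicit Arguments. Unset Strict Implicit. Unset Printing Implicit Defensive.
Import Order.TTheory GRing.Theory Num.Theory Normc.
Local Open Scope ring_scope.

(** Let [m(x)] be the mean of [e(x k^d)] over [1 <= k <= N].  On a cyclic
    group [Z/M] with [M] huge, two applications of Hausdorff-Young and
    Hoelder's inequality reduce the estimate to the moment bound
    [sum_t |m(t/M)|^s <= C M N^-d] with [1/s = 1/p - 1/p']; the hypothesis on [p]
    says exactly that [s > s0 := d (2^(d-1) + 1)].

    Write [d! t / M = a/q + b] by Dirichlet's theorem.  Weyl differencing gives
    [|m|^(2^(d-1)) <= C (N^(e-1) + (q (1 + N^d |b|))^(-3/4))] with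
    [e = 1 / (2^(d-1) + 1)].  The loss [N^e] from the divisor function is
    confined to the differences [h_1 ... h_(d-1)] not divisible by [q], while the
    multiples of [q] cost only a power of the number of divisors of [q].
    Raised to the power [s0 / 2^(d-1)], which exceeds [d >= 3], the first term
    becomes [N^-d] and the second is summable over all rationals [a/q], because
    [3 * 3/4 > 2]. *)

(** * Divisors and Diophantine approximation *)

(** The moment bound has the right order: when [M] is at least [N^d], the frequencies with [|t / M|]
    below a small multiple of [N^-d] already contribute about [M N^-d]. A loss of any power of [N]
    near a rational with small [q] would therefore be fatal, so the divisor bound may touch only the
    term [N^(e-1)]. There the loss is free: [s0 / 2^(d-1)] is slightly larger than [d], and [e] is
    the value for which [(e - 1) s0 / 2^(d-1)] is exactly [-d].

    The exponent [3/4] is [1] minus the [1/4] spent on powers of the number of divisors of [q]. Its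
    triple is [9/4]: about [d! q] numerators [a] belong to each [q], which leaves the convergent sum
    of [q^(-5/4)], while an inverse square is enough for the sum over [t].

    All powers of [M] cancel, so [M] can be chosen after the finite window of integers under study,
    large enough to exclude wrap-around. Hausdorff-Young is needed only up to a constant, so real
    interpolation between [l^1] and [l^2] provides it for [p < 2]; at [p = 2] the averages are plain
    contractions. *)

(** Multiplication maps pairs of divisors onto the divisors of [m * n]: [e] is the product of
    [gcdn e m], which divides [m], and its cofactor, which divides [n]. *)
Lemma leq_size_divisorsM (m n : nat) : (0 < m)%N -> (0 < n)%N ->
  (size (divisors (m * n)) <= size (divisors m) * size (divisors n))%N.
Proof.
move=> m0 n0; rewrite -(size_allpairs muln) uniq_leq_size ?divisors_uniq// => e.
rewrite -dvdn_divisors ?muln_gt0 ?m0// => emn.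
have e0 : (0 < e)%N by apply: dvdn_gt0 emn; rewrite muln_gt0 m0.
apply/allpairsP; exists (gcdn e m, e %/ gcdn e m)%N; split => /=.
- by rewrite -dvdn_divisors// dvdn_gcdr.
- rewrite -dvdn_divisors// -(@Gauss_dvdr _ (m %/ gcdn e m)).
    have g0 : (0 < gcdn e m)%N by rewrite gcdn_gt0 e0.
    by rewrite -(@dvdn_pmul2l (gcdn e m))// mulnA
       ![(gcdn e m * (_ %/ _))%N]mulnC !divnK ?dvdn_gcdl ?dvdn_gcdr.
  have g0 : (0 < gcdn e m)%N by rewrite gcdn_gt0 e0.
  rewrite /coprime -(@eqn_pmul2l (gcdn e m))// muln_gcdr.
  by rewrite ![(gcdn e m * (_ %/ _))%N]mulnC !divnK ?dvdn_gcdl ?dvdn_gcdr// muln1.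
- by rewrite mulnC divnK// dvdn_gcdl.
Qed.

Lemma size_divisors_pfactor (p a : nat) : prime p ->
  (size (divisors (p ^ a)) <= a.+1)%N.
Proof.
move=> pp.
have -> : a.+1 = size [seq (p ^ i)%N | i <- iota 0 a.+1] by rewrite size_map size_iota.
rewrite uniq_leq_size ?divisors_uniq// => e.
rewrite -dvdn_divisors ?expn_gt0 ?prime_gt0// => /(dvdn_pfactor _ _ pp)[b ba ->].
by apply/map_f; rewrite mem_iota.
Qed.

(** This is the [k]-th power of [a + 1 <= k (a %/ k + 1) <= k 2 ^ (a %/ k)]. *)
Lemma expSn_leq_exp2 (k a : nat) : (a.+1 ^ k <= k ^ k * 2 ^ a)%N.
Proof.
case: k => [|k]; first by rewrite !expn0 mul1n expn_gt0.
have h : (a.+1 <= k.+1 * 2 ^ (a %/ k.+1))%N.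
  apply: leq_trans (leq_mul (leqnn _) (ltn_expl _ (ltnSn 1))).
  by rewrite mulnC; apply: ltn_ceil.
have := h; rewrite -(@leq_exp2r _ _ k.+1)// => /leq_trans; apply.
rewrite expnMn leq_mul2l -expnM leq_exp2l// leq_divM orbT//.
Qed.

(* A prime [r >= 2 ^ k] satisfies [(a + 1) ^ k <= r ^ a], and each of the
   finitely many smaller primes costs a factor [k ^ k]; [j] counts the latter. *)
Lemma size_divisors_exp_rough (k j n : nat) : (0 < n)%N ->
  (forall r, prime r -> r %| n -> 2 ^ k - j <= r)%N ->
  (size (divisors n) ^ k <= (k ^ k) ^ j * n)%N.
Proof.
have kk0 : (0 < k ^ k)%N by case: (k) => // k'; rewrite expn_gt0.
have strip r a m : prime r -> (0 < m)%N ->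
    (size (divisors (r ^ a * m)) ^ k <= a.+1 ^ k * size (divisors m) ^ k)%N.
  move=> pr m0; rewrite -expnMn; case: k {kk0} => [|k]; first by rewrite !expn0.
  rewrite leq_exp2r//; apply: leq_trans (leq_size_divisorsM _ _) _ => //.
    by rewrite expn_gt0 prime_gt0.
  by rewrite leq_mul2r size_divisors_pfactor// orbT.
elim: j n => [|j IHj] n.
  elim/ltn_ind: n => n IHn n0 hn.
  have [n1|n1] := leqP n 1.
    have -> : n = 1%N by lia.
    by rewrite expn0 exp1n.
  pose r := pdiv n; have pr : prime r by exact: pdiv_prime.
  have rn : (r %| n)%N by exact: pdiv_dvd.
  have [a cm nE] := pfactor_coprime pr n0.
  have a0 : (0 < logn r n)%N by rewrite logn_gt0 mem_primes pr n0.
  have m0 : (0 < a)%N by move: n0; rewrite nE muln_gt0 => /andP[].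
  rewrite nE mulnC; apply: (leq_trans (strip _ _ _ pr m0)).
  rewrite expn0 mul1n; apply: leq_mul; last first.
    rewrite -[leqRHS]mul1n -{1}(expn0 (k ^ k)); apply: IHn => //.
      rewrite [ltnRHS]nE -{1}(muln1 a) ltn_pmul2l//.
      by rewrite -(expn0 r) ltn_exp2l// prime_gt1.
    move=> t pt ta; apply: hn => //; rewrite nE; exact: dvdn_mulr.
  have h2 : (2 ^ k <= r)%N by have := hn r pr rn; rewrite subn0.
  set b := logn r n.
  apply: (@leq_trans ((2 ^ b) ^ k)%N).
    by case: (k) => [|k']; rewrite ?expn0// leq_exp2r// ltn_expl.
  rewrite -expnM mulnC expnM; have [->|b0] := posnP b; first by rewrite !expn0.
  by rewrite leq_exp2r.
move=> n0 hn.
(* Going from [j + 1] to [j] excludes the single value [2 ^ k - (j + 1)] as a prime factor. If it is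
   prime, its full power is split off at the cost of one factor [k ^ k]. *)
have [pr|npr] := boolP (prime (2 ^ k - j.+1)); last first.
  apply: (@leq_trans ((k ^ k) ^ j * n)%N); last by rewrite leq_mul2r expnS leq_pmull ?orbT.
  apply: IHj => // r pr' rn; have := hn r pr' rn.
  rewrite leq_eqVlt => /orP[/eqP e|]; last by lia.
  by move: npr; rewrite e pr'.
set r := (2 ^ k - j.+1)%N in pr hn.
have [a cm nE] := pfactor_coprime pr n0.
have m0 : (0 < a)%N by move: n0; rewrite nE muln_gt0 => /andP[].
rewrite nE mulnC; apply: (leq_trans (strip _ _ _ pr m0)).
have H : (size (divisors a) ^ k <= (k ^ k) ^ j * a)%N.
  apply: IHj => // t pt ta.
  have tn : (t %| n)%N by rewrite nE; exact: dvdn_mulr.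
  have := hn t pt tn; rewrite /r leq_eqVlt => /orP[/eqP e|]; last by lia.
  by move: cm; rewrite -/r in e; rewrite e prime_coprime// ta.
apply: (leq_trans (leq_mul (expSn_leq_exp2 _ _) H)).
rewrite expnS -!mulnA leq_mul2l; apply/orP; right.
rewrite mulnCA leq_mul2l; apply/orP; right.
rewrite mulnC mulnC leq_mul2r; apply/orP; right.
have [->|b0] := posnP (logn r n); first by rewrite !expn0.
by rewrite leq_exp2r// prime_gt1.
Qed.

(** For [j = 2 ^ k] the condition on the prime factors is void. *)
Lemma size_divisors_exp_leq (k n : nat) : (0 < n)%N ->
  (size (divisors n) ^ k <= (k ^ k) ^ (2 ^ k) * n)%N.
Proof.
by move=> n0; apply: size_divisors_exp_rough => // r _ _; rewrite subnn.
Qed.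

(* The two inequalities say [|q x / M - a| <= 1 / D], without denominators. *)
Lemma dirichlet_approx (x M D : nat) : (0 < M)%N -> (0 < D)%N ->
  exists q a : nat, [/\ (0 < q <= D)%N, coprime a q,
    (D * (q * x) <= D * (a * M) + M)%N & (D * (a * M) <= D * (q * x) + M)%N].
Proof.
move=> M0 D0.
(* Lets the approximation survive division of [a] and [q] by their gcd. *)
have canc X Y g : (0 < g -> X * g <= Y * g + M -> X <= Y + M)%N by nia.
(* Pigeonhole: [F i] numbers the arc, among [D] equal arcs of the circle, that contains [i x / M]
   modulo 1; two of the [D + 1] points share an arc. *)
pose F (i : 'I_D.+1) : 'I_D := Ordinal (ltn_pmod ((D * i * x) %/ M) D0).
have [q [a [qD hi lo]]] : exists q a : nat, [/\ (0 < q <= D)%N,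
    (D * (q * x) <= D * (a * M) + M)%N & (D * (a * M) <= D * (q * x) + M)%N].
  have : ~~ injectiveb F.
    apply/negP => /injectiveP/leq_card; rewrite !card_ord ltnn//.
  case/injectivePn => i [j]; wlog ij : i j / (i < j)%N => [H|].
    move=> neq e; have [ij|ij|] := ltngtP i j; first exact: (H i j).
      by apply: (H j i) => //; rewrite eq_sym.
    by move/val_inj => eij; move: neq; rewrite eij eqxx.
  move=> _ /(congr1 val) /= e.
  set u := (D * i * x)%N in e; set v := (D * j * x)%N in e.
  have uv : (u <= v)%N by rewrite /u /v leq_mul2r leq_mul2l ltnW ?orbT// .
  have /eqP := e; rewrite eq_sym eqn_mod_dvd ?leq_div2r// => /dvdnP[a ha].
  exists (j - i)%N, a.
  have ju : (D * ((j - i) * x) = v - u)%N by rewrite /u /v mulnBl mulnBr !mulnA.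
  have := divn_eq u M; have := divn_eq v M.
  have := ltn_pmod u M0; have := ltn_pmod v M0.
  have : (v %/ M = u %/ M + a * D)%N by have := leq_div2r M uv; lia.
  move: (u %/ M)%N (v %/ M)%N (u %% M)%N (v %% M)%N => U V r s -> h1 h2 h3 h4.
  have jD := ltn_ord j.
  have E : ((U + a * D) * M = U * M + D * (a * M))%N by rewrite mulnDl mulnA (mulnC a).
  rewrite E in h3; rewrite ju; split; lia.
have q0 : (0 < q)%N by case/andP: qD.
have g0 : (0 < gcdn a q)%N by rewrite gcdn_gt0 q0 orbT.
exists (q %/ gcdn a q)%N, (a %/ gcdn a q)%N.
have aE : (a %/ gcdn a q * gcdn a q = a)%N by rewrite divnK ?dvdn_gcdl.
have qE : (q %/ gcdn a q * gcdn a q = q)%N by rewrite divnK ?dvdn_gcdr.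
split.
- rewrite divn_gt0// dvdn_leq ?dvdn_gcdr//=.
  by apply: leq_trans (leq_div _ _) _; case/andP: qD.
- rewrite /coprime -(@eqn_pmul2l (gcdn a q))// muln_gcdr muln1.
  by rewrite ![(gcdn a q * _)%N]mulnC aE qE.
- move: aE qE; move: (gcdn a q) g0 => g g0; move: (a %/ g)%N (q %/ g)%N => a' q' aE qE.
  move: hi; rewrite -aE -qE (_ : D * (q' * g * x) = D * (q' * x) * g)%N; last by rewrite -!mulnA (mulnC x).
  rewrite (_ : D * (a' * g * M) = D * (a' * M) * g)%N; last by rewrite -!mulnA (mulnC M).
  exact: canc.
- move: aE qE; move: (gcdn a q) g0 => g g0; move: (a %/ g)%N (q %/ g)%N => a' q' aE qE.
  move: lo; rewrite -aE -qE (_ : D * (q' * g * x) = D * (q' * x) * g)%N; last by rewrite -!mulnA (mulnC x).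
  rewrite (_ : D * (a' * g * M) = D * (a' * M) * g)%N; last by rewrite -!mulnA (mulnC M).
  exact: canc.
Qed.

(** * Elementary sums *)

Section RealSums.
Variable R : realType.
Implicit Types (x y u c e : R).

Lemma ler_sum_nat_widen (m n n' : nat) (F : nat -> R) : (n <= n')%N ->
  (forall i, 0 <= F i) -> \sum_(m <= i < n) F i <= \sum_(m <= i < n') F i.
Proof.
move=> nn F0; have [mn|mn] := leqP m n; last first.
  by rewrite big_geq ?(ltnW mn)// sumr_ge0.
by rewrite (big_cat_nat mn nn)/= lerDl sumr_ge0.
Qed.

Lemma powRD_gt0 x y c : 0 < x -> x `^ (y + c) = x `^ y * x `^ c.
Proof. by move=> x0; rewrite powRD// (gt_eqF x0) implybT. Qed.

(** Telescoping: each term is at most [2 / e] times the increment of [r ^ e]. *)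
Lemma sum_powRN_le e (n : nat) : 0 < e <= 1 ->
  \sum_(1 <= r < n.+1) r%:R `^ (e - 1) <= 2 / e * n%:R `^ e.
Proof.
move=> /andP[e0 e1].
suff step (r : nat) : (r.+1)%:R `^ (e - 1) <= 2 / e * (r.+1%:R `^ e - r%:R `^ e).
  elim: n => [|n IHn].
    by rewrite big_geq// powR0 ?gt_eqF// mulr0.
  rewrite big_nat_recr//=; have := lerD IHn (step n).
  by rewrite -mulrDr subrKC.
have r0 : (0 : R) < r.+1%:R by rewrite ltr0n.
have -> : r.+1%:R `^ (e - 1) = r.+1%:R `^ e / r.+1%:R :> R.
  by rewrite powRD_gt0// powR_inv1// ltW.
suff : (r%:R : R) `^ e <= r.+1%:R `^ e * (1 - e / 2 / r.+1%:R).
  move=> h; rewrite mulrAC ler_pdivlMr// mulrAC ler_pdivrMr//.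
  rewrite -(ler_pM2l (_ : 0 < 1 / 2 :> R)) ?divr_gt0//.
  move: h; set A := _ `^ e; set B := _ `^ e => h.
  have h2 : B * (1 - e / 2 / r.+1%:R) * r.+1%:R = B * r.+1%:R - B * e / 2.
    by field; rewrite gt_eqF.
  have := ler_wpM2r (ltW r0) h; rewrite h2; lra.
have -> : (r%:R : R) = r.+1%:R * (1 - r.+1%:R^-1).
  by rewrite mulrBr mulr1 divff ?gt_eqF// -natr1 addrK.
set v : R := r.+1%:R^-1.
have v0 : 0 < v by rewrite invr_gt0.
have v1 : v <= 1 by rewrite invf_le1// ler1n.
rewrite powRM ?subr_ge0 ?(ltW r0)//; apply: ler_wpM2l; first exact: powR_ge0.
rewrite -/v.
have [->|vn1] := eqVneq v 1; first by rewrite subrr powR0 ?gt_eqF//; lra.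
have v1' : 0 < 1 - v by rewrite subr_gt0 lt_neqAle vn1.
(* [(1 - v)^e <= (1 + e v)^-1] follows from [ln (1 + x) <= x] at [-v] and at [e v]; then
   [(1 + w)^-1 <= 1 - w / 2] on [[0, 1]]. *)
apply: (@le_trans _ _ (1 + e * v)^-1).
  rewrite -[leRHS]powR_inv1; last by rewrite addr_ge0 ?mulr_ge0 ?ltW.
  rewrite /powR !gt_eqF//; last by rewrite ltr_wpDr ?mulr_ge0 ?ltW.
  rewrite ler_expR mulN1r.
  have h1 := @le_ln1Dx R (- v); have h2 := @le_ln1Dx R (e * v).
  have {h1} : ln (1 - v) <= - v by apply: h1; lra.
  have {h2} : ln (1 + e * v) <= e * v by apply: h2; nra.
  move=> h2 h1; nra.
have w0 : 0 < e * v by rewrite mulr_gt0.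
have w1 : e * v <= 1 by rewrite mulr_ile1// ltW.
rewrite [e / 2 * v]mulrAC; move: (e * v) w0 w1 => w w0 w1.
by rewrite -[leLHS]mul1r ler_pdivrMr; nra.
Qed.

(** Telescoping: the term at [r + 1] is at most [(r^-e - (r + 1)^-e) / e], which reduces to
    [1 / (r + 1) <= ln (1 + 1 / r)]. *)
Lemma sum_powRN1_le e (n : nat) : 0 < e ->
  \sum_(1 <= r < n.+1) r%:R `^ (- (1 + e)) <= 1 + e^-1.
Proof.
move=> e0.
have [->|n0] := posnP n; first by rewrite big_geq// addr_ge0 ?invr_ge0 ?ltW.
have step (r : nat) : (0 < r)%N ->
    (r.+1)%:R `^ (- (1 + e)) <= e^-1 * (r%:R `^ (- e) - r.+1%:R `^ (- e)) :> R.
  move=> r0; have r1 : (0 : R) < r%:R by rewrite ltr0n.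
  have r2 : (0 : R) < r.+1%:R by rewrite ltr0n.
  rewrite -(ler_pM2l e0) mulrA divff ?gt_eqF// mul1r.
  have -> : r%:R `^ (- e) = r.+1%:R `^ (- e) * (1 + r%:R^-1) `^ e :> R.
    have -> : (1 + r%:R^-1 : R) = r.+1%:R / r%:R.
      by rewrite -natr1 mulrDl divff ?gt_eqF// mul1r.
    rewrite powRM ?invr_ge0 ?ltW// mulrA -powRD_gt0//.
    by rewrite addNr powRr0 mul1r -[in RHS]powR_inv1 ?ltW// -powRrM mulN1r.
  rewrite opprD addrC powRD_gt0//.
  rewrite powR_inv1 ?(ltW r2)//.
  suff h : e * r.+1%:R^-1 <= (1 + r%:R^-1) `^ e - 1.
    by have := ler_wpM2l (powR_ge0 r.+1%:R (- e)) h; rewrite mulrBr mulr1 mulrCA.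
  have h0 : 0 < 1 + r%:R^-1 :> R by rewrite addr_gt0 ?invr_gt0.
  rewrite /powR gt_eqF//; have := expR_ge1Dx (e * ln (1 + r%:R^-1)).
  suff : r.+1%:R^-1 <= ln (1 + r%:R^-1) :> R.
    move=> h; have := ler_wpM2l (ltW e0) h.
    by move: (expR _) => Z; move: (e * ln _) (e * _^-1) => X Y; lra.
  have -> : (1 + r%:R^-1 : R) = (r.+1%:R^-1 * r%:R)^-1.
    by rewrite invfM invrK -natr1 mulrDl divff ?gt_eqF// mul1r.
  rewrite lnV ?posrE ?mulr_gt0 ?invr_gt0//.
  have -> : r.+1%:R^-1 * r%:R = 1 - r.+1%:R^-1 :> R.
    by rewrite -natr1; field; rewrite natr1 gt_eqF.
  have := @le_ln1Dx R (- r.+1%:R^-1).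
  have : r.+1%:R^-1 < 1 :> R by rewrite invf_lt1// ltr1n ltnS.
  by rewrite ltrN2 lerNr => h; apply.
suff : \sum_(1 <= r < n.+1) r%:R `^ (- (1 + e)) <= 1 + e^-1 * (1 - n%:R `^ (- e)) :> R.
  move/le_trans; apply; rewrite lerD2l -[leRHS]mulr1.
  apply: ler_wpM2l; first by rewrite invr_ge0 ltW.
  by have := powR_ge0 (n%:R : R) (- e); lra.
elim: n n0 => // n IHn _; have [->|n0] := posnP n.
  by rewrite big_nat1 !powR1 subrr mulr0 addr0.
rewrite big_nat_recr//=; have := lerD (IHn n0) (step n n0).
move=> /le_trans; apply; rewrite -addrA -mulrDr; rewrite lerD2l.
apply: ler_wpM2l; [by rewrite invr_ge0 ltW|lra].
Qed.

(** Replacing one factor of the square by its predecessor gives a telescoping sum, and [u <= 1]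
    absorbs the term [j = 0]. *)
Lemma sum_invSqr_le u (n : nat) : 0 < u <= 1 ->
  \sum_(0 <= j < n) (1 + u * j%:R) ^- 2 <= 2 / u.
Proof.
move=> /andP[u0 u1].
have pos (j : nat) : 0 < 1 + u * j%:R by rewrite ltr_pwDl// mulr_ge0// ltW.
have ui : 1 <= u^-1 by rewrite invf_ge1.
suff : \sum_(0 <= j < n.+1) (1 + u * j%:R) ^- 2 <= 1 + u^-1 * (1 - (1 + u * n%:R)^-1).
  move=> h; apply: (@le_trans _ _ (\sum_(0 <= j < n.+1) (1 + u * j%:R) ^- 2)).
    by apply: ler_sum_nat_widen => // i; rewrite invr_ge0 exprn_ge0 ?ltW.
  apply: le_trans h _.
  have : 0 <= (1 + u * n%:R)^-1 by rewrite invr_ge0 ltW.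
  nra.
elim: n => [|n IHn].
  by rewrite big_nat1 mulr0 addr0 expr1n invr1 subrr mulr0 addr0.
rewrite big_nat_recr//=; have p1 := pos n; have p2 := pos n.+1.
suff : (1 + u * n.+1%:R) ^- 2 <= u^-1 * ((1 + u * n%:R)^-1 - (1 + u * n.+1%:R)^-1).
  move=> h; have := lerD IHn h; move/le_trans; apply.
  by rewrite -addrA -mulrDr lerD2l; apply: ler_wpM2l; [rewrite invr_ge0 ltW|lra].
have -> : u^-1 * ((1 + u * n%:R)^-1 - (1 + u * n.+1%:R)^-1) =
    (1 + u * n%:R)^-1 * (1 + u * n.+1%:R)^-1.
  by rewrite -natr1 in p2 *; field; rewrite !gt_eqF.
rewrite expr2 invfM; apply: ler_wpM2r; first by rewrite invr_ge0 ltW.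
by rewrite lef_pV2 ?posrE// lerD2l ler_pM2l// ler_nat.
Qed.

(** Cutting at [Num.truncn c] leaves two one-sided sums, whose successive terms lie at distance at
    least 0, 1, 2, ... from [c]. *)
Lemma sum_invSqr_dist_le u c (n : nat) : 0 < u <= 1 -> 0 <= c ->
  \sum_(0 <= t < n) (1 + u * `|t%:R - c|) ^- 2 <= 4 / u.
Proof.
move=> u01 c0; have /andP[u0 u1] := u01.
have mono x y : 0 <= x -> x <= y -> (1 + u * y) ^- 2 <= (1 + u * x) ^- 2.
  move=> x0 xy; have y0 := le_trans x0 xy.
  rewrite lef_pV2 ?posrE ?exprn_gt0 ?ltr_pwDl ?mulr_ge0 ?(ltW u0)//.
  by rewrite ler_pXn2r// ?nnegrE ?addr_ge0 ?mulr_ge0 ?(ltW u0)// lerD2l ler_pM2l.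
have /andP[m1 m2] := truncn_itv c0; set m := Num.truncn c in m1 m2.
have F0 t : 0 <= (1 + u * `|t%:R - c|) ^- 2.
  by rewrite invr_ge0 exprn_ge0// addr_ge0// mulr_ge0// ltW.
apply: le_trans (ler_sum_nat_widen 0 (leq_addl m.+1 n) F0) _.
rewrite (big_cat_nat (leq0n m.+1) (leq_addr _ _))/=.
have -> : 4 / u = 2 / u + 2 / u by lra.
apply: lerD.
  rewrite big_nat_rev/= add0n; apply: le_trans (sum_invSqr_le m.+1 u01).
  apply: ler_sum_nat => i /andP[_ im]; apply: mono => //.
  rewrite subSS natrB// ler0_norm; last by have : (0 : R) <= i%:R by []; lra.
  lra.
rewrite -{1}(add0n m.+1) big_addn; apply: le_trans (sum_invSqr_le _ u01).
apply: ler_sum_nat => i _; apply: mono => //.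
rewrite natrD ger0_norm; last by have : (0 : R) <= i%:R by []; lra.
lra.
Qed.

Lemma sqr_mean_le (I : Type) (r : seq I) (F : I -> R) (N : nat) :
  (0 < N)%N -> (size r <= N)%N ->
  (N%:R^-1 * \sum_(i <- r) F i) ^+ 2 <= N%:R^-1 * \sum_(i <- r) F i ^+ 2.
Proof.
move=> N0 rN; have N1 : (0 : R) < N%:R by rewrite ltr0n.
set a := N%:R^-1 * \sum_(i <- r) F i.
have h : \sum_(i <- r) (2 * a * F i - a ^+ 2) <= \sum_(i <- r) F i ^+ 2.
  by apply: ler_sum => i _; have := sqr_ge0 (F i - a); nra.
rewrite -subr_ge0.
have : N%:R^-1 * \sum_(i <- r) (2 * a * F i - a ^+ 2) <= N%:R^-1 * \sum_(i <- r) F i ^+ 2.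
  by rewrite ler_pM2l// invr_gt0.
rewrite sumrB -mulr_sumr big_const_seq count_predT iter_addr_0 mulrBr.
have -> : N%:R^-1 * (2 * a * \sum_(i <- r) F i) = 2 * a ^+ 2.
  by rewrite mulrCA -/a expr2 mulrA.
have : N%:R^-1 * (a ^+ 2 *+ size r) <= a ^+ 2.
  rewrite mulrC ler_pdivrMr// -mulr_natr; apply: ler_wpM2l; first exact: sqr_ge0.
  by rewrite ler_nat.
lra.
Qed.

Lemma exp2_mean_le (I : Type) (r : seq I) (F : I -> R) (N k : nat) :
  (0 < N)%N -> (size r <= N)%N -> (forall i, 0 <= F i) ->
  (N%:R^-1 * \sum_(i <- r) F i) ^+ (2 ^ k) <= N%:R^-1 * \sum_(i <- r) F i ^+ (2 ^ k).
Proof.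
move=> N0 rN F0; elim: k => [|k IHk]; first by rewrite expn0 expr1.
rewrite expnSr exprM.
apply: le_trans (_ : (N%:R^-1 * \sum_(i <- r) F i ^+ (2 ^ k)) ^+ 2 <= _).
  rewrite ler_pXn2r// nnegrE ?exprn_ge0// mulr_ge0 ?invr_ge0 ?ler0n ?sumr_ge0//.
  by move=> i _; rewrite exprn_ge0.
apply: le_trans (sqr_mean_le _ N0 rN) _.
rewrite le_eqVlt; apply/orP; left; apply/eqP; congr (_ * _).
by apply: eq_bigr => i _; rewrite -exprM -expnSr.
Qed.

End RealSums.

(** * Exponential sums and Weyl differencing *)

Section ComplexExponential.
Variable R : realType.
Implicit Types (x y b c : R) (z w : R[i]).

Definition expi x : R[i] := Complex (cos (pi *+ 2 * x)) (sin (pi *+ 2 * x)).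

Lemma normc_ge0 z : 0 <= normc z.
Proof. by case: z => a b; rewrite /normc sqrtr_ge0. Qed.

Lemma Re_le_normc z : complex.Re z <= normc z.
Proof.
case: z => a b; rewrite /normc; apply: (le_trans (ler_norm a)).
by rewrite -sqrtr_sqr ler_wsqrtr// lerDl sqr_ge0.
Qed.

Lemma normc_sum (I : Type) (r : seq I) (P : pred I) (F : I -> R[i]) :
  normc (\sum_(i <- r | P i) F i) <= \sum_(i <- r | P i) normc (F i).
Proof.
elim/big_rec2: _ => [|i y z _ h]; first by rewrite normc0.
by apply: le_trans (le_normcD _ _) _; rewrite lerD2l.
Qed.

Lemma normcX z (n : nat) : normc (z ^+ n) = normc z ^+ n.
Proof. by elim: n => [|n IHn]; rewrite ?expr0 ?normc1// !exprS normcM IHn. Qed.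

Lemma normc_conj z : normc (conjc z) = normc z.
Proof. by case: z => a b; rewrite /normc /= sqrrN. Qed.

Lemma normc_real x : normc (Complex x 0) = `|x|.
Proof. by rewrite /normc expr0n addr0 sqrtr_sqr. Qed.

Lemma mulc_conj z : z * conjc z = Complex (normc z ^+ 2) 0.
Proof.
case: z => a b; rewrite /normc sqr_sqrtr ?addr_ge0 ?sqr_ge0//.
by rewrite /GRing.mul/=; congr Complex; ring.
Qed.

Lemma expiD x y : expi (x + y) = expi x * expi y.
Proof.
by rewrite /expi mulrDr cosD sinD {3}/GRing.mul/=; congr Complex; rewrite addrC mulrC.
Qed.

Lemma expi0 : expi 0 = 1.
Proof. by rewrite /expi mulr0 cos0 sin0. Qed.

Lemma normc_expi x : normc (expi x) = 1.
Proof. by rewrite /normc /expi cos2Dsin2 sqrtr1. Qed.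

Lemma expi1 : expi 1 = 1.
Proof. by rewrite /expi mulr1 cos2pi sin2pi. Qed.

Lemma expiXn x (n : nat) : expi (x * n%:R) = expi x ^+ n.
Proof.
elim: n => [|n IHn]; first by rewrite mulr0 expi0.
by rewrite -natr1 mulrDr mulr1 expiD IHn exprSr.
Qed.

Lemma expi_nat (n : nat) : expi n%:R = 1.
Proof. by rewrite -(mul1r n%:R) expiXn expi1 expr1n. Qed.

Lemma expiDn x (n : nat) : expi (x + n%:R) = expi x.
Proof. by rewrite expiD expi_nat mulr1. Qed.

Lemma expiN x : expi (- x) = conjc (expi x).
Proof. by rewrite /expi mulrN cosN sinN. Qed.

Lemma normc_1BexpiN x : normc (1 - expi (- x)) = normc (1 - expi x).
Proof. by rewrite expiN -[RHS]normc_conj rmorphB rmorph1. Qed.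

(* Doubling [x] at most doubles [|1 - e(x)|], which is at least [1] once
   [x] lies in [[1/4, 1/2]]. *)
Lemma normc_1Bexpi_ge_half x : 0 <= x <= 2^-1 -> 2 * x <= normc (1 - expi x).
Proof.
move=> /andP[]; rewrite le_eqVlt => /orP[/eqP<- _|x0 xh].
  by rewrite mulr0 normc_ge0.
have [n] : exists n : nat, 4^-1 <= 2 ^+ n * x.
  have [n hn] : exists n : nat, x^-1 <= n%:R.
    by exists (Num.truncn x^-1).+1; rewrite ltW// truncnS_gt.
  exists n; rewrite -(ler_pM2r (_ : 0 < x^-1)) ?invr_gt0// mulfK ?gt_eqF//.
  apply: (@le_trans _ _ x^-1); first by rewrite ler_piMl// ?invr_ge0 ?ltW//; lra.
  apply: le_trans hn _; rewrite -natrX ler_nat; exact/ltnW/ltn_expl.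
have base y : y <= 2^-1 -> 4^-1 <= y -> 2 * y <= normc (1 - expi y).
  move=> yh y4.
  have hc : cos (pi *+ 2 * y) <= 0.
    rewrite -oppr_ge0 -cosDpi.
    have -> : cos (pi *+ 2 * y + pi) = cos (pi *+ 2 * y - pi).
      by rewrite -[RHS]cosD2pi; congr cos; ring.
    apply: cos_ge0_pihalf; have := @pi_gt0 R; nra.
  have : 1 - cos (pi *+ 2 * y) <= normc (1 - expi y) by exact: Re_le_normc (1 - expi y).
  lra.
elim: n x x0 xh => [|n IHn] x x0 xh h; first by rewrite expr0 mul1r in h; exact: base.
have [h4|h4] := leP 4^-1 x; first exact: base.
have : 2 * (x + x) <= normc (1 - expi (x + x)).
  apply: IHn; [lra|lra|]; rewrite exprS in h; lra.
have -> : 1 - expi (x + x) = (1 - expi x) * (1 + expi x) by rewrite expiD; ring.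
rewrite normcM => h5.
have : normc (1 + expi x) <= 2.
  by apply: le_trans (le_normcD _ _) _; rewrite normc1 normc_expi.
have := normc_ge0 (1 - expi x); nra.
Qed.

(** The product [x (1 - x)] replaces the distance to the nearest integer, so that one formula serves
    both halves of the period. *)
Lemma normc_1Bexpi_ge x : 0 <= x <= 1 -> 2 * (x * (1 - x)) <= normc (1 - expi x).
Proof.
move=> /andP[x0 x1]; have [xh|xh] := leP x 2^-1.
  apply: le_trans (normc_1Bexpi_ge_half _); last by rewrite x0.
  by nra.
have -> : normc (1 - expi x) = normc (1 - expi (1 - x)).
  by rewrite -normc_1BexpiN [1 - x]addrC (expiDn (- x) 1).
apply: le_trans (normc_1Bexpi_ge_half _); last by apply/andP; split; lra.
by nra.
Qed.

(** The product form avoids a case distinction on [expi c = 1]. *)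
Lemma normc_geom_sum b c (n : nat) :
  normc (\sum_(0 <= x < n) expi (c * x%:R + b)) * normc (1 - expi c) <= 2.
Proof.
have -> : \sum_(0 <= x < n) expi (c * x%:R + b) =
    expi b * \sum_(0 <= x < n) expi c ^+ x.
  by rewrite big_distrr/=; apply: eq_bigr => x _; rewrite expiD expiXn mulrC.
rewrite normcM normc_expi mul1r -normcM mulrC.
rewrite big_mkord -(opprB (expi c)) mulNr -subrX1 normcN.
apply: le_trans (le_normcD _ _) _.
by rewrite normcN normc1 normcX normc_expi expr1n.
Qed.

(** The terms of the squared sum are grouped by the difference [h] of the two indices; [h] and [-h]
    give conjugate sums, hence the factor 2. *)
Lemma sqr_normc_sum_le (F : nat -> R[i]) (n : nat) :
  normc (\sum_(0 <= x < n) F x) ^+ 2 <= \sum_(0 <= x < n) normc (F x) ^+ 2 +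
    2 * \sum_(1 <= h < n) normc (\sum_(0 <= x < n - h) F (x + h)%N * conjc (F x)).
Proof.
pose A h m := \sum_(0 <= x < m - h) F (x + h)%N * conjc (F x).
have sqE : (\sum_(0 <= x < n) F x) * conjc (\sum_(0 <= x < n) F x) =
    \sum_(0 <= x < n) F x * conjc (F x) + \sum_(1 <= h < n) (A h n + conjc (A h n)).
  elim: n => [|n IHn]; first by rewrite !big_geq// mul0r addr0.
  have [n0|n0] := posnP n.
    by rewrite n0 [in RHS](@big_geq _ _ _ 1 1)// !big_nat1 addr0.
  have -> : \sum_(1 <= h < n.+1) (A h n.+1 + conjc (A h n.+1)) =
      \sum_(1 <= h < n) (A h n + conjc (A h n)) +
      (F n * conjc (\sum_(0 <= x < n) F x) + conjc (F n) * \sum_(0 <= x < n) F x).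
    have -> : \sum_(1 <= h < n.+1) (A h n.+1 + conjc (A h n.+1)) =
       \sum_(1 <= h < n.+1) ((A h n + conjc (A h n)) +
         (F n * conjc (F (n - h)%N) + conjc (F n) * F (n - h)%N)).
      apply: eq_big_nat => h /andP[h0 hn]; rewrite /A subSn// big_nat_recr//=.
      rewrite subnK// rmorphD/= rmorphM/= conjcK; ring.
    rewrite big_split/=; congr (_ + _).
      have A0 : A n n = 0 by rewrite /A subnn big_geq.
      by rewrite big_nat_recr//= A0 conjc0 !addr0.
    rewrite big_split/= rmorph_sum/= !big_distrr/=; congr (_ + _).
      rewrite big_nat_rev/= add1n big_add1/= big_nat_cond [RHS]big_nat_cond.
      by apply: eq_bigr => i /andP[/andP[_ i_n] _]; rewrite !subSS subKn// ltnW.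
    rewrite big_nat_rev/= add1n big_add1/= big_nat_cond [RHS]big_nat_cond.
    by apply: eq_bigr => i /andP[/andP[_ i_n] _]; rewrite !subSS subKn// ltnW.
  rewrite !big_nat_recr//= rmorphD/= mulrDl !mulrDr IHn; ring.
rewrite expr2 -{2}normc_conj -normcM sqE.
apply: le_trans (le_normcD _ _) _; apply: lerD.
  apply: le_trans (normc_sum _ _ _) _; apply: ler_sum => i _.
  by rewrite normcM normc_conj expr2.
apply: le_trans (normc_sum _ _ _) _; rewrite mulr_sumr; apply: ler_sum => h _.
by apply: le_trans (le_normcD _ _) _; rewrite normc_conj mulr2n mulrDl !mul1r.
Qed.

End ComplexExponential.

(** * Weyl differencing of polynomial phases *)

Section WeylDifferencing.
Variable R : realType.
Implicit Types (b c : R) (phi psi : nat -> R).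

(* [phi] is a polynomial of degree at most [k + 1] whose [(k + 1)]-st finite
   difference with unit steps is [c]. *)
Fixpoint polyphase (k : nat) c phi : Prop :=
  if k is k'.+1 then
    forall h : nat, polyphase k' (h%:R * c) (fun x => phi (x + h)%N - phi x)
  else exists b, forall x, phi x = c * x%:R + b.

Lemma eq_polyphase k c phi psi : phi =1 psi -> polyphase k c phi -> polyphase k c psi.
Proof.
elim: k c phi psi => [|k IHk] c phi psi e /=.
  by case=> b hb; exists b => x; rewrite -e hb.
by move=> H h; apply: IHk (H h) => x; rewrite !e.
Qed.

Lemma polyphaseD k c c' phi psi : polyphase k c phi -> polyphase k c' psi ->
  polyphase k (c + c') (fun x => phi x + psi x).
Proof.
elim: k c c' phi psi => [|k IHk] c c' phi psi /=.
  by case=> b hb [b' hb']; exists (b + b') => x; rewrite hb hb'; ring.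
move=> H H' h; rewrite mulrDr; apply: eq_polyphase (IHk _ _ _ _ (H h) (H' h)) => x /=.
ring.
Qed.

Lemma polyphaseZ k a c phi : polyphase k c phi -> polyphase k (a * c) (fun x => a * phi x).
Proof.
elim: k c phi => [|k IHk] c phi /=.
  by case=> b hb; exists (a * b) => x; rewrite hb; ring.
move=> H h; rewrite mulrCA; apply: eq_polyphase (IHk _ _ (H h)) => x /=; ring.
Qed.

Lemma polyphase_shift k c (s : nat) phi :
  polyphase k c phi -> polyphase k c (fun x => phi (x + s)%N).
Proof.
elim: k c phi => [|k IHk] c phi /=.
  by case=> b hb; exists (c * s%:R + b) => x; rewrite hb natrD; ring.
move=> H h; apply: eq_polyphase (IHk _ _ (H h)) => x /=; by rewrite addnAC.
Qed.

(** Product rule: the difference of [x phi(x)] is [x] times the difference of [phi], plus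
    [h phi(x + h)]; the second summand raises the coefficient from [k + 2] to [k + 3] in the
    induction. *)
Lemma polyphaseMX k c phi : polyphase k c phi ->
  polyphase k.+1 (k.+2%:R * c) (fun x => x%:R * phi x).
Proof.
elim: k c phi => [|k IHk] c phi.
  move=> [b hb] h; exists (c * h%:R ^+ 2 + b * h%:R) => x; rewrite !hb natrD; ring.
move=> H h.
have H1 := IHk _ _ (H h).
have H2 := polyphaseZ h%:R (polyphase_shift h H).
have -> : h%:R * (k.+3%:R * c) = k.+2%:R * (h%:R * c) + h%:R * c.
  by rewrite -[k.+3%:R]natr1; ring.
by apply: eq_polyphase (polyphaseD H1 H2) => x; rewrite natrD; ring.
Qed.

Lemma polyphaseXn k : polyphase k (k.+1)`!%:R (fun x => x%:R ^+ k.+1).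
Proof.
elim: k => [|k IHk]; first by exists 0 => x; rewrite expr1 (_ : 1`! = 1%N)// mul1r addr0.
rewrite factS natrM; apply: eq_polyphase (polyphaseMX IHk) => x.
by rewrite [RHS]exprS.
Qed.

(** The maximum over lengths is needed because differencing shortens the range by varying amounts,
    and one quantity has to control all the resulting linear sums. *)
Definition linsum (N : nat) c : R :=
  N%:R^-1 * \big[Num.max/0]_(0 <= n < N.+1) normc (\sum_(0 <= x < n) expi (c * x%:R)).

Lemma linsum_bound (N n : nat) b c : (0 < N)%N -> (n <= N)%N ->
  N%:R^-1 * normc (\sum_(0 <= x < n) expi (c * x%:R + b)) <= linsum N c.
Proof.
move=> N0 nN; rewrite ler_wpM2l ?invr_ge0//.
have -> : normc (\sum_(0 <= x < n) expi (c * x%:R + b)) =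
    normc (\sum_(0 <= x < n) expi (c * x%:R)).
  under eq_bigr do rewrite expiD.
  by rewrite -big_distrl/= normcM normc_expi mulr1.
pose F m := normc (\sum_(0 <= x < m) expi (c * x%:R)).
by apply: (le_bigmax_seq 0 n xpredT F) => //; rewrite mem_index_iota ltnS.
Qed.

Lemma linsum_ge0 N c : 0 <= linsum N c.
Proof.
rewrite mulr_ge0 ?invr_ge0//; elim/big_ind: _ => // [x y x0 y0|i _].
  by rewrite le_max x0.
exact: normc_ge0.
Qed.

Lemma linsum_le1 N c : linsum N c <= 1.
Proof.
rewrite /linsum; have [->|N0] := posnP N; first by rewrite invr0 mul0r.
rewrite mulrC ler_pdivrMr ?ltr0n// mul1r.
rewrite big_nat_cond; elim/big_ind: _ => // [x y x0 y0|i].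
  by rewrite ge_max x0.
rewrite andbT ltnS => /andP[_ iN]; apply: le_trans (normc_sum _ _ _) _.
under eq_bigr do rewrite normc_expi.
by rewrite sumr_const_nat subn0 ler_nat.
Qed.

Lemma linsum_geom N c : N%:R * (linsum N c * normc (1 - expi c)) <= 2.
Proof.
have [->|N0] := posnP N; first by rewrite mul0r.
rewrite /linsum mulrA mulVKf ?pnatr_eq0 -?lt0n//.
elim/big_ind: _ => [|x y x0 y0|i _]; first by rewrite mul0r.
  by rewrite maxEle; case: ifP.
by have := normc_geom_sum 0 c i; under eq_bigr do rewrite addr0.
Qed.

Lemma linsum_periodic N c (n : nat) : linsum N (c + n%:R) = linsum N c.
Proof.
congr (_ * _); apply: eq_bigr => i _; congr normc; apply: eq_bigr => x _.
by rewrite mulrDl -natrM expiDn.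
Qed.

(* The sum of [G (h_1 * ... * h_k)] over [1 <= h_1, ..., h_k < N]. *)
Fixpoint mulsum (N k : nat) (G : nat -> R) : R :=
  if k is k'.+1 then \sum_(1 <= h < N) mulsum N k' (fun l => G (h * l)%N) else G 1%N.

Lemma eq_mulsum N k (G H : nat -> R) : G =1 H -> mulsum N k G = mulsum N k H.
Proof.
elim: k G H => [|k IHk] G H e /=; first exact: e.
by apply: eq_bigr => h _; apply: IHk => l; rewrite e.
Qed.

Lemma le_mulsum N k (G H : nat -> R) :
  (forall l, (0 < l <= N ^ k)%N -> G l <= H l) -> mulsum N k G <= mulsum N k H.
Proof.
elim: k G H => [|k IHk] G H e /=; first exact: e.
apply: ler_sum_nat => h /andP[h0 hN]; apply: IHk => l /andP[l0 lN].
by rewrite e// muln_gt0 h0 l0 expnS leq_mul// ltnW.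
Qed.

Lemma mulsum_ge0 N k (G : nat -> R) : (forall l, 0 <= G l) -> 0 <= mulsum N k G.
Proof.
elim: k G => [|k IHk] G e /=; first exact: e.
by apply: sumr_ge0 => h _; apply: IHk.
Qed.

Lemma mulsumD N k (G H : nat -> R) :
  mulsum N k (fun l => G l + H l) = mulsum N k G + mulsum N k H.
Proof.
elim: k G H => [|k IHk] G H //=.
by rewrite -big_split/=; apply: eq_bigr => h _; rewrite IHk.
Qed.

Lemma mulsumZ N k a (G : nat -> R) : mulsum N k (fun l => a * G l) = a * mulsum N k G.
Proof.
elim: k G => [|k IHk] G //=.
by rewrite big_distrr/=; apply: eq_bigr => h _; rewrite IHk.
Qed.

(** Squaring replaces the phase by its differences, whose coefficient gains the factor [h]; the
    power mean inequality then moves the exponent [2 ^ k] inside the mean over [h]. After [k] rounds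
    the phases are linear. Admitting every length [n <= N] lets the induction hypothesis apply to
    the shortened sums. *)
Lemma weyl_differencing k : exists2 C : R, 0 < C & forall (N n : nat) c phi,
  (0 < N)%N -> (n <= N)%N -> polyphase k c phi ->
  (N%:R^-1 * normc (\sum_(0 <= x < n) expi (phi x))) ^+ (2 ^ k) <=
  C * (N%:R^-1 + N%:R ^- k * mulsum N k (fun l => linsum N (l%:R * c))).
Proof.
elim: k => [|k [C C0 IHk]].
  exists 1 => // N n c phi N0 nN [b hb].
  rewrite expn0 expr1 expr0 invr1 !mul1r /=.
  under eq_bigr do rewrite hb.
  apply: le_trans (linsum_bound _ _ N0 nN) _.
  by rewrite mul1r lerDr invr_ge0.
exists (1 + 2 ^+ (2 ^ k) * C).
  by rewrite addr_gt0// mulr_gt0// exprn_gt0.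
move=> N n c phi N0 nN H.
have N1 : (0 : R) < N%:R by rewrite ltr0n.
pose S h := \sum_(0 <= x < n - h) expi (phi (x + h)%N - phi x).
(* The value 1 at [h = 0] bounds the diagonal terms, which end up as [N^-1]. *)
pose B (h : nat) := if h == 0%N then 1 else 2 * (N%:R^-1 * normc (S h)).
have B0 h : 0 <= B h.
  by rewrite /B; case: eqP => // _; rewrite !mulr_ge0 ?invr_ge0 ?normc_ge0.
have sq : (N%:R^-1 * normc (\sum_(0 <= x < n) expi (phi x))) ^+ 2 <=
    N%:R^-1 * \sum_(0 <= h < N) B h.
  rewrite exprMn expr2 -mulrA ler_pM2l ?invr_gt0//.
  rewrite mulrC ler_pdivrMr//; apply: le_trans (sqr_normc_sum_le _ _) _.
  rewrite [\sum_(0 <= h < N) B h]big_ltn// [leRHS]mulrDl; apply: lerD.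
    under eq_bigr do rewrite normc_expi expr1n.
    by rewrite sumr_const_nat subn0 /B eqxx mul1r ler_nat.
  rewrite big_distrl/= mulr_sumr.
  apply: le_trans (ler_sum_nat_widen 1 nN _) _.
    by move=> i; rewrite mulr_ge0// normc_ge0.
  apply: ler_sum_nat => h /andP[h0 hN].
  rewrite /B gtn_eqF// -mulrA ler_pM2l// mulrAC mulVf ?gt_eqF// mul1r.
  rewrite le_eqVlt; apply/orP; left; apply/eqP; congr normc.
  by apply: eq_bigr => x _; rewrite expiD expiN.
rewrite expnS exprM.
apply: le_trans (_ : (N%:R^-1 * \sum_(0 <= h < N) B h) ^+ (2 ^ k) <= _).
  rewrite ler_pXn2r ?nnegrE ?expn_gt0 ?sqr_ge0//.
  by rewrite mulr_ge0 ?invr_ge0// sumr_ge0.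
apply: le_trans (exp2_mean_le k N0 _ B0) _; first by rewrite size_iota subn0.
rewrite big_ltn// {1}/B eqxx expr1n mulrDr mulr1 mulrDl mul1r.
set T := mulsum _ _ _.
have T0 : 0 <= T by apply: mulsum_ge0 => l; exact: linsum_ge0.
apply: lerD; first by rewrite lerDl mulr_ge0// ?invr_ge0 ?exprn_ge0.
have Bh h : (0 < h)%N -> B h ^+ (2 ^ k) <= 2 ^+ (2 ^ k) * (C * (N%:R^-1 +
    N%:R ^- k * mulsum N k (fun l => linsum N ((h * l)%N%:R * c)))).
  move=> h0; rewrite /B gtn_eqF// exprMn ler_pM2l ?exprn_gt0//.
  apply: le_trans (IHk N (n - h)%N (h%:R * c) _ N0 _ (H h)) _.
    exact: leq_trans (leq_subr _ _) nN.
  rewrite ler_pM2l// lerD2l ler_wpM2l ?invr_ge0 ?exprn_ge0//.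
  by apply: le_mulsum => l _; rewrite natrM mulrA [l%:R * _]mulrC.
apply: (@le_trans _ _ (N%:R^-1 * \sum_(1 <= h < N) (2 ^+ (2 ^ k) * (C * (N%:R^-1 +
    N%:R ^- k * mulsum N k (fun l => linsum N ((h * l)%N%:R * c))))))).
  by rewrite ler_pM2l ?invr_gt0//; apply: ler_sum_nat => h /andP[h0 _]; exact: Bh.
rewrite -!mulr_sumr big_split/= -mulr_sumr -/T.
rewrite mulrCA -mulrA ler_pM2l ?exprn_gt0// mulrCA ler_pM2l//.
rewrite mulrDr exprS invfM -mulrA lerD2r sumr_const_nat -(mulr_natr N%:R^-1).
rewrite -[leRHS]mulr1 ler_pM2l ?invr_gt0// mulrC ler_pdivrMr// mul1r ler_nat.
by rewrite leq_subr.
Qed.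

End WeylDifferencing.

(** * Sums over products of the differencing variables *)

Section WeylInequality.
Variable R : realType.
Implicit Types (e x y : R).

(** The integer bound for the [m]-th power with [m > 1 / e], after taking [m]-th roots. *)
Lemma size_divisors_le_powR e : 0 < e ->
  exists2 C : R, 0 < C & forall n : nat, (0 < n)%N ->
    (size (divisors n))%:R <= C * n%:R `^ e.
Proof.
move=> e0; pose m := (Num.truncn e^-1).+1.
have m0 : (0 : R) < m%:R by rewrite ltr0n.
have me : m%:R^-1 <= e.
  by rewrite -[leRHS]invrK lef_pV2 ?posrE ?invr_gt0// ltW// truncnS_gt.
pose A : R := ((m ^ m) ^ (2 ^ m))%N%:R.
have A0 : 0 < A by rewrite ltr0n !expn_gt0.
exists (A `^ m%:R^-1); first exact: powR_gt0.
move=> n n0; have n1 : (0 : R) < n%:R by rewrite ltr0n.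
apply: (@le_trans _ _ ((A * n%:R) `^ m%:R^-1)); last first.
  rewrite powRM ?(ltW A0)//; apply: ler_wpM2l; first exact: powR_ge0.
  by apply: ler_powR; rewrite ?ler1n.
have -> : (size (divisors n))%:R = ((size (divisors n))%:R ^+ m) `^ m%:R^-1 :> R.
  by rewrite -powR_mulrn// -powRrM divff ?gt_eqF// powRr1.
apply: ge0_ler_powR; rewrite ?invr_ge0 ?nnegrE ?exprn_ge0 ?mulr_ge0 ?(ltW A0)//.
by rewrite -natrX -natrM ler_nat; exact: size_divisors_exp_leq.
Qed.

Lemma big_nat_dvd (V : nmodType) (h n : nat) (G : nat -> V) : (0 < h)%N ->
  \sum_(1 <= m < n.+1 | (h %| m)%N) G m = \sum_(1 <= l < (n %/ h).+1) G (h * l)%N.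
Proof.
move=> h0; elim: n => [|n IHn]; first by rewrite div0n !big_geq.
rewrite big_mkcond big_nat_recr//= -big_mkcond/= IHn divnS//; case: ifPn => hn.
  rewrite add1n [RHS]big_nat_recr//=; congr (_ + G _).
  by rewrite -{1}(divnK hn) divnS// hn add1n mulnC.
by rewrite addr0.
Qed.

(** A number [m] can be written as [h * l] in at most as many ways as it has divisors, so each
    variable merged into the product costs one factor [A]. *)
Lemma mulsum_le_sum (N k : nat) (A : R) (G : nat -> R) : (0 < N)%N ->
  (forall l, 0 <= G l) ->
  (forall l, (0 < l <= N ^ k)%N -> (size (divisors l))%:R <= A) ->
  mulsum N k G <= A ^+ k * \sum_(1 <= l < (N ^ k).+1) G l.
Proof.
move=> N0; elim: k G => [|k IHk] G G0 HA.
  by rewrite expr0 mul1r expn0 big_nat1.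
have A0 : 0 <= A.
  by apply: le_trans (HA 1%N _); rewrite ?expn_gt0 ?N0.
have HA' l : (0 < l <= N ^ k)%N -> (size (divisors l))%:R <= A.
  move=> /andP[l0 lk]; apply: HA; rewrite l0 (leq_trans lk)//.
  by rewrite expnS leq_pmull.
rewrite /=.
apply: (@le_trans _ _ (\sum_(1 <= h < N) (A ^+ k *
    \sum_(1 <= m < (N ^ k.+1).+1 | (h %| m)%N) G m))).
  apply: ler_sum_nat => h /andP[h0 hN].
  apply: le_trans (IHk _ _ HA') _ => //.
  apply: ler_wpM2l; first exact: exprn_ge0.
  rewrite big_nat_dvd//; apply: ler_sum_nat_widen => //.
  by rewrite ltnS leq_divRL// expnS mulnC leq_mul2r ltnW ?orbT.
rewrite -mulr_sumr exprSr -mulrA; apply: ler_wpM2l; first exact: exprn_ge0.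
rewrite [leLHS](eq_bigr (fun h => \sum_(1 <= m < (N ^ k.+1).+1)
  if (h %| m)%N then G m else 0)); last by move=> h _; rewrite big_mkcond.
rewrite exchange_big/= mulr_sumr; apply: ler_sum_nat => m m0N.
have /andP[m0 _] := m0N.
rewrite -big_mkcond/= big_const_seq iter_addr_0 -mulr_natl.
apply: ler_wpM2r => //; apply: le_trans (HA m m0N); rewrite ler_nat -size_filter.
rewrite uniq_leq_size ?filter_uniq ?iota_uniq// => h.
by rewrite mem_filter -dvdn_divisors// => /andP[].
Qed.

(** The gcd is at most the sum of all common divisors [g]. The multiples of [g] contribute [g^e]
    times a sum up to [N / g], hence about [N^e] whatever [g] is, so the loss is the number of
    divisors of [q]. *)
Lemma sum_gcd_powR_le (N q : nat) e : (0 < q)%N -> 0 < e <= 1 ->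
  \sum_(1 <= h < N) h%:R `^ (e - 1) * (gcdn q h)%:R <=
  (size (divisors q))%:R * (2 / e) * N%:R `^ e.
Proof.
move=> q0 e01; have /andP[e0 e1] := e01.
have [->|N0] := posnP N.
  by rewrite big_geq// !mulr_ge0 ?powR_ge0 ?invr_ge0 ?(ltW e0).
rewrite -(ltn_predK N0).
apply: (@le_trans _ _ (\sum_(1 <= h < N.-1.+1) \sum_(g <- divisors q)
   (if (g %| h)%N then g%:R * h%:R `^ (e - 1) else 0))).
  apply: ler_sum_nat => h /andP[h0 _].
  rewrite (bigD1_seq (gcdn q h)) ?divisors_uniq//=; last first.
    by rewrite -dvdn_divisors// dvdn_gcdl.
  rewrite dvdn_gcdr mulrC lerDl sumr_ge0// => g _.
  by case: ifP => // _; rewrite mulr_ge0// powR_ge0.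
rewrite exchange_big/=.
apply: (@le_trans _ _ (\sum_(g <- divisors q) (2 / e * N%:R `^ e))); last first.
  by rewrite (ltn_predK N0) big_const_seq count_predT iter_addr_0 -(mulr_natl (2 / e * _)) mulrA.
rewrite !big_seq; apply: ler_sum => g; rewrite -dvdn_divisors// => gq.
have g0 : (0 < g)%N by exact: dvdn_gt0 gq.
have g1 : (0 : R) < g%:R by rewrite ltr0n.
rewrite -big_mkcond/= big_nat_dvd//.
under eq_bigr => l _ do rewrite natrM powRM// mulrA.
rewrite -mulr_sumr.
have -> : g%:R * g%:R `^ (e - 1) = g%:R `^ e by exact: mulr_powRB1.
apply: le_trans (ler_wpM2l (powR_ge0 _ _) (sum_powRN_le _ e01)) _.
rewrite mulrCA; apply: ler_wpM2l; first by rewrite divr_ge0 ?(ltW e0).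
rewrite -powRM//; apply: ge0_ler_powR; rewrite ?nnegrE ?(ltW e0) ?mulr_ge0//.
by rewrite -natrM ler_nat mulnC (leq_trans (leq_divM _ _))// leq_pred.
Qed.

(* [q | c h l] forces [q | c (gcd q h) l]; this lets the coefficient [c] absorb
   the common factors of [q] with the successive variables. *)
Lemma mulsum_dvd_le (N k q c : nat) e : (0 < q)%N -> (0 < c)%N -> 0 < e <= 1 ->
  mulsum N k (fun l => (q %| c * l)%N%:R * l%:R `^ (e - 1)) <=
  ((size (divisors q))%:R * (2 / e) * N%:R `^ e) ^+ k * (c%:R / q%:R).
Proof.
move=> q0 + e01; have /andP[e0 e1] := e01.
have q1 : (0 : R) < q%:R by rewrite ltr0n.
elim: k c => [|k IHk] c c0 /=.
  rewrite expr0 mul1r powR1 mulr1 muln1; case: (boolP (q %| c)%N) => [qc|_]; last by rewrite divr_ge0.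
  by rewrite ler_pdivlMr// mul1r ler_nat dvdn_leq.
set K := _ * _ * _; have K0 : 0 <= K.
  by rewrite !mulr_ge0 ?powR_ge0 ?invr_ge0 ?(ltW e0).
apply: (@le_trans _ _ (\sum_(1 <= h < N) K ^+ k * (c%:R / q%:R) *
    (h%:R `^ (e - 1) * (gcdn q h)%:R))).
  apply: ler_sum_nat => h /andP[h0 _].
  apply: (@le_trans _ _ (mulsum N k (fun l => h%:R `^ (e - 1) *
      ((q %| (c * gcdn q h) * l)%N%:R * l%:R `^ (e - 1))))).
    apply: le_mulsum => l /andP[l0 _].
    rewrite natrM powRM// mulrCA; apply: ler_wpM2l; first exact: powR_ge0.
    apply: ler_wpM2r; first exact: powR_ge0.
    rewrite ler_nat; case: (boolP (q %| c * (h * l))%N) => // qd.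
    suff -> : (q %| c * gcdn q h * l)%N by [].
    rewrite mulnAC muln_gcdr dvdn_gcd dvdn_mull//=.
    by rewrite -mulnA (mulnC l).
  rewrite mulsumZ.
  have cg : (0 < c * gcdn q h)%N by rewrite muln_gt0 c0 gcdn_gt0 q0.
  apply: le_trans (ler_wpM2l (powR_ge0 _ _) (IHk _ cg)) _.
  rewrite natrM le_eqVlt; apply/orP; left; apply/eqP; ring.
rewrite -mulr_sumr exprSr [leRHS]mulrAC; apply: ler_wpM2l.
  by rewrite mulr_ge0 ?exprn_ge0 ?divr_ge0.
exact: sum_gcd_powR_le.
Qed.

(** Modulo 1 the coefficient is [r / q] with [0 < r < q], moved by [l b] of size at most
    [1 / (2 q)]. The shift is at most half of the distances [r / q] and [(q - r) / q] to 0 and 1,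
    which therefore survive up to a factor 2. *)
Lemma linsum_nondvd_le (N L a q : nat) (b : R) (l : nat) : (0 < q)%N -> coprime a q ->
  (0 < N)%N -> (0 < l <= L)%N -> `|b| * (2 * q%:R * L%:R) <= 1 -> ~~ (q %| l)%N ->
  linsum N (l%:R * (a%:R / q%:R + b)) <= 2 * q%:R / N%:R *
    (((a * l) %% q)%N%:R^-1 + (q - (a * l) %% q)%N%:R^-1).
Proof.
move=> q0 aq N0 /andP[l0 lL] hb ql.
have q1 : (0 : R) < q%:R by rewrite ltr0n.
have N1 : (0 : R) < N%:R by rewrite ltr0n.
have l1 : (0 : R) < l%:R by rewrite ltr0n.
set r := ((a * l) %% q)%N.
have rq : (r < q)%N by rewrite ltn_mod.
have r0 : (0 < r)%N.
  by rewrite lt0n; apply: contra ql; rewrite -/(dvdn q (a * l)) Gauss_dvdr// coprime_sym.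
have r1 : (1 : R) <= r%:R by rewrite ler1n.
have qr1 : (r%:R : R) + 1 <= q%:R by rewrite natr1 ler_nat.
pose y : R := r%:R / q%:R + l%:R * b.
have -> : linsum N (l%:R * (a%:R / q%:R + b)) = linsum N y.
  rewrite -(linsum_periodic N y ((a * l) %/ q)); congr linsum.
  have E : (a * l)%N%:R = ((a * l) %/ q)%N%:R * q%:R + r%:R :> R.
    by rewrite -natrM -natrD -divn_eq.
  have -> : (((a * l) %/ q)%N%:R : R) = (l%:R * a%:R - r%:R) / q%:R.
    by rewrite -natrM (mulnC l) E addrK mulfK ?gt_eqF.
  by rewrite /y; field; rewrite gt_eqF.
have hlb : `|l%:R * b| * (2 * q%:R) <= 1.
  rewrite normrM ger0_norm//; apply: le_trans hb.
  rewrite mulrAC mulrC -!mulrA ler_wpM2l// mulrC -mulrA ler_wpM2l//.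
  by rewrite ler_pM2l// ler_nat.
have /andP[y1 y2] : (r%:R / (2 * q%:R) <= y) && (y <= 1 - (q%:R - r%:R) / (2 * q%:R)).
  move: hlb; rewrite /y; move: (l%:R * b) => z hz.
  have hz' : `|z| <= (2 * q%:R)^-1 by rewrite -[leRHS]mul1r ler_pdivlMr ?mulr_gt0.
  have := ler_norm z; have := ler_norm (- z); rewrite normrN.
  have -> : r%:R / q%:R = r%:R * 2 * (2 * q%:R)^-1 :> R by field; rewrite gt_eqF.
  have : 1 = 2 * q%:R * (2 * q%:R)^-1 :> R by rewrite divff// mulf_neq0 ?gt_eqF.
  have : 0 < (2 * q%:R)^-1 :> R by rewrite invr_gt0 mulr_gt0.
  move: hz'; move: ((2 * q%:R)^-1) => v.
  by move=> h1 h2 h3 h4 h5; apply/andP; split; nra.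
have y0 : 0 < y by apply: lt_le_trans y1; rewrite divr_gt0 ?mulr_gt0//; lra.
have y0' : 0 < 1 - y.
  have : 0 < (q%:R - r%:R) / (2 * q%:R) :> R by rewrite divr_gt0 ?mulr_gt0//; lra.
  lra.
have hn := @normc_1Bexpi_ge R y ltac:(apply/andP; split; lra).
have hg := linsum_geom N y.
apply: (@le_trans _ _ (N%:R^-1 * (y^-1 + (1 - y)^-1))).
  have -> : y^-1 + (1 - y)^-1 = (y * (1 - y))^-1 by field; rewrite !gt_eqF.
  rewrite -invfM -[leRHS]mul1r ler_pdivlMr ?mulr_gt0//.
  have h3 : linsum N y * (2 * (y * (1 - y))) <= linsum N y * normc (1 - expi y).
    by apply: ler_wpM2l => //; exact: linsum_ge0.
  have := ler_wpM2l (ltW N1) h3; lra.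
rewrite [2 * _ / _]mulrC -mulrA ler_pM2l ?invr_gt0// mulrDr natrB; last exact: ltnW.
apply: lerD.
  by rewrite -[leRHS]invrK invfM invrK mulrC lef_pV2// posrE ?divr_gt0 ?mulr_gt0//; lra.
rewrite -[leRHS]invrK invfM invrK mulrC lef_pV2// ?posrE//; first by lra.
by rewrite divr_gt0 ?mulr_gt0//; lra.
Qed.

Lemma sum_nat_periodic (q n : nat) (F : nat -> R) : (forall i, F (i + q)%N = F i) ->
  \sum_(0 <= i < n * q) F i = n%:R * \sum_(0 <= i < q) F i.
Proof.
move=> Fq; have Fnq m i : F (i + m * q)%N = F i.
  by elim: m => [|m IHm]; rewrite ?addn0// mulSn addnCA addnC Fq.
elim: n => [|n IHn]; first by rewrite big_geq// mul0r.
rewrite (@big_cat_nat _ _ _ (n * q))//=; last by rewrite mulSn leq_addl.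
rewrite IHn -natr1 mulrDl mul1r; congr (_ + _).
rewrite -{1}(add0n (n * q)%N) big_addn mulSn addnK.
by apply: eq_bigr => i _; rewrite Fnq.
Qed.

(** As [l] runs through a period, [a l] runs through all residues modulo [q]. Each of the
    [L %/ q + 1] periods thus contributes two harmonic sums, of size [q^e] at most up to a
    constant. *)
Lemma sum_linsum_nondvd_le (N L a q : nat) (b e : R) : (0 < q)%N -> coprime a q ->
  (0 < N)%N -> `|b| * (2 * q%:R * L%:R) <= 1 -> 0 < e <= 1 ->
  \sum_(1 <= l < L.+1 | ~~ (q %| l)%N) linsum N (l%:R * (a%:R / q%:R + b)) <=
  8 / e * ((L + q)%N%:R / N%:R) * q%:R `^ e.
Proof.
move=> q0 aq N0 hb e01; have /andP[e0 e1] := e01.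
have q1 : (0 : R) < q%:R by rewrite ltr0n.
have N1 : (0 : R) < N%:R by rewrite ltr0n.
(* [w 0] is [1 / q], the inverse of 0 being 0, so putting the multiples of [q] back to complete the
   periods only enlarges the sum. *)
pose w (r : nat) : R := r%:R^-1 + (q - r)%N%:R^-1.
have w0 r : 0 <= w r by rewrite addr_ge0 ?invr_ge0.
pose H : R := \sum_(1 <= r < q.+1) r%:R^-1.
have HE : H <= 2 / e * q%:R `^ e.
  apply: le_trans (sum_powRN_le _ e01); apply: ler_sum_nat => r /andP[r0 _].
  rewrite -powR_inv1//; apply: ler_powR; first by rewrite ler1n.
  lra.
have sw : \sum_(0 <= r < q) w r <= 2 * H.
  rewrite big_split/= mulr2n mulrDl mul1r; apply: lerD.
    rewrite big_ltn// invr0 add0r; by apply: ler_sum_nat_widen => // i; rewrite invr_ge0.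
  rewrite big_nat_rev/= add0n /H big_add1/=.
  by apply: ler_sum_nat => i /andP[_ iq]; rewrite subKn.
have swa : \sum_(0 <= i < q) w ((a * i) %% q)%N = \sum_(0 <= r < q) w r.
  rewrite !big_mkord.
  pose f (i : 'I_q) : 'I_q := Ordinal (ltn_pmod (a * i) q0).
  rewrite [RHS](reindex_inj (h := f))//= => i j /(congr1 val)/= /eqP.
  wlog ij : i j / (i <= j)%N.
    move=> W h; have [ij|/ltnW ij] := leqP i j; first exact: W.
    by apply/esym/W => //; rewrite eq_sym.
  rewrite eq_sym eqn_mod_dvd; last by rewrite leq_mul2l ij orbT.
  rewrite -mulnBr Gauss_dvdr; last by rewrite coprime_sym.
  move=> qd; apply/val_inj/eqP; rewrite /= eqn_leq ij/= -subn_eq0.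
  apply: contraTT qd; rewrite -lt0n => h; rewrite gtnNdvd//.
  by rewrite (leq_ltn_trans (leq_subr _ _)).
apply: (@le_trans _ _ (\sum_(1 <= l < L.+1 | ~~ (q %| l)%N)
    (2 * q%:R / N%:R * w ((a * l) %% q)%N))).
  rewrite big_nat_cond [leRHS]big_nat_cond; apply: ler_sum => l.
  by move=> /andP[lL ql]; apply: linsum_nondvd_le hb ql.
rewrite -mulr_sumr.
apply: (@le_trans _ _ (2 * q%:R / N%:R * ((L %/ q).+1%:R * (2 * H)))).
  apply: ler_wpM2l; first by rewrite divr_ge0 ?mulr_ge0.
  apply: (@le_trans _ _ (\sum_(0 <= l < (L %/ q).+1 * q) w ((a * l) %% q)%N)).
    rewrite big_mkcond/=.
    apply: (@le_trans _ _ (\sum_(0 <= l < L.+1) w ((a * l) %% q)%N)).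
      rewrite [leRHS]big_ltn// -[leLHS]add0r; apply: lerD => //.
      by apply: ler_sum => i _; case: ifP.
    apply: ler_sum_nat_widen => //; exact: ltn_ceil.
  rewrite (@sum_nat_periodic q _ (fun l => w ((a * l) %% q)%N)); last first.
    by move=> i; rewrite mulnDr addnC modnMDl.
  by rewrite swa ler_wpM2l.
have h1 : q%:R * (L %/ q).+1%:R <= (L + q)%N%:R :> R.
  by rewrite -natrM ler_nat mulnS addnC leq_add2r mulnC leq_divM.
apply: (@le_trans _ _ (2 / N%:R * ((L + q)%N%:R * (2 * H)))).
  have -> : 2 * q%:R / N%:R * ((L %/ q).+1%:R * (2 * H)) =
    2 / N%:R * ((q%:R * (L %/ q).+1%:R) * (2 * H)) by field; rewrite gt_eqF.
  apply: ler_wpM2l; first by rewrite divr_ge0.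
  by apply: ler_wpM2r h1; rewrite mulr_ge0// sumr_ge0// => i _; rewrite invr_ge0.
have -> : 8 / e * ((L + q)%N%:R / N%:R) * q%:R `^ e =
    2 / N%:R * ((L + q)%N%:R * (2 * (2 / e * q%:R `^ e))) by ring.
apply: ler_wpM2l; first by rewrite divr_ge0.
by apply: ler_wpM2l => //; rewrite ler_pM2l.
Qed.

(** When [q] divides [l] the rational part is an integer and drops out. Then [linsum] is at most 1
    and at most [1 / (N l |b|)], and the power [-e] interpolates between the two. *)
Lemma linsum_dvd_le (N L a q : nat) (b e : R) (l : nat) : (0 < q)%N ->
  (0 < N)%N -> (0 < l <= L)%N -> `|b| * (2 * q%:R * L%:R) <= 1 -> (q %| l)%N ->
  b != 0 -> 0 < e <= 1 ->
  linsum N (l%:R * (a%:R / q%:R + b)) <= (N%:R * `|b|) `^ (- e) * l%:R `^ (- e).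
Proof.
move=> q0 N0 /andP[l0 lL] hb /dvdnP[m lE] b0 /andP[e0 e1].
have q1 : (0 : R) < q%:R by rewrite ltr0n.
have N1 : (0 : R) < N%:R by rewrite ltr0n.
have l1 : (0 : R) < l%:R by rewrite ltr0n.
have b1 : 0 < `|b| by rewrite normr_gt0.
have -> : linsum N (l%:R * (a%:R / q%:R + b)) = linsum N (l%:R * b).
  rewrite -(linsum_periodic N (l%:R * b) (m * a)); congr linsum.
  by rewrite lE !natrM; field; rewrite gt_eqF.
rewrite -powRM ?mulr_ge0// powRN -mulrA [`|b| * _]mulrC.
have lb : l%:R * `|b| <= 2^-1.
  rewrite -[leRHS]mul1r ler_pdivlMr//; apply: le_trans hb.
  have -> : l%:R * `|b| * 2 = `|b| * (l%:R * 2) by ring.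
  apply: ler_wpM2l => //.
  have q2 : (1 : R) <= q%:R by rewrite ler1n.
  have lL' : (l%:R : R) <= L%:R by rewrite ler_nat.
  nra.
set g := linsum N _.
have g0 : 0 <= g by exact: linsum_ge0.
have hg : N%:R * (g * (2 * (l%:R * `|b|))) <= 2.
  apply: le_trans (linsum_geom N (l%:R * b)).
  apply: ler_wpM2l => //; apply: ler_wpM2l => //.
  have -> : normc (1 - expi (l%:R * b)) = normc (1 - expi (l%:R * `|b|)).
    by case: (ger0P b) => // _; rewrite mulrN normc_1BexpiN.
  by apply: normc_1Bexpi_ge_half; rewrite lb mulr_ge0.
have [->|gn0] := eqVneq g 0; first by rewrite invr_ge0 powR_ge0.
have gp : 0 < g by rewrite lt_neqAle eq_sym gn0.
have z0 : 0 < N%:R * (l%:R * `|b|) by rewrite !mulr_gt0.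
apply: (@le_trans _ _ (g `^ e)).
  by apply: ger1_powR => //; rewrite gp linsum_le1.
rewrite -[leRHS]mul1r ler_pdivlMr ?powR_gt0// -powRM ?(ltW gp) ?(ltW z0)//.
rewrite [leRHS](_ : 1 = 1 `^ e); last by rewrite powR1.
apply: ge0_ler_powR; rewrite ?nnegrE ?(ltW e0)//.
  by rewrite mulr_ge0 ?(ltW z0).
move: hg; lra.
Qed.

End WeylInequality.

(** * Weyl's inequality with the divisor loss confined *)

Section WeylBound.
Variable R : realType.
Implicit Types (b e : R).

Lemma mulsum_linsum_nondvd_le (k : nat) e : 0 < e <= 1 ->
  exists2 C : R, 0 < C & forall (N a q : nat) b, (0 < N)%N ->
    (0 < q <= 2 * N ^ k)%N -> coprime a q -> `|b| * (2 * q%:R * (N ^ k)%N%:R) <= 1 ->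
    N%:R ^- k * mulsum N k (fun l => (~~ (q %| l)%N)%:R *
      linsum N (l%:R * (a%:R / q%:R + b))) <= C * N%:R `^ (e - 1).
Proof.
move=> /andP[e0 e1].
have k1 : (1 : R) <= k.+1%:R by rewrite ler1n.
have k0 : (0 : R) <= k%:R by [].
have k10 : (0 : R) < k.+1%:R by rewrite ltr0n.
(* The loss [N^e] is shared equally: [e1'] makes [q^e1'], the price of the harmonic sums, cost at
   most [N^(e/2)], and [e2] does so for the [k] divisor factors [A], up to constants. *)
pose e1' := e / 2 / k.+1%:R; pose e2 := e1' / k.+1%:R.
have e1p : 0 < e1' by rewrite !divr_gt0.
have e1l : e1' <= 1 by rewrite ler_pdivrMr// mul1r; lra.
have e2p : 0 < e2 by rewrite divr_gt0.
have ke1 : k%:R * e1' <= e / 2.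
  by rewrite mulrC /e1' mulrAC ler_pdivrMr// ler_wpM2l ?divr_ge0 ?(ltW e0)// ler_nat.
have ke2 : k%:R * e2 * k%:R <= e / 2.
  apply: le_trans ke1; rewrite mulrC ler_wpM2l//.
  by rewrite mulrC /e2 mulrAC ler_pdivrMr// ler_wpM2l ?(ltW e1p)// ler_nat.
have [D D0 HD] := size_divisors_le_powR e2p.
exists (D ^+ k * (48 / e1')); first by rewrite !mulr_gt0 ?exprn_gt0 ?invr_gt0.
move=> N a q b N0 /andP[q0 qL] aq hb.
have N1 : (0 : R) < N%:R by rewrite ltr0n.
have N2 : (1 : R) <= N%:R by rewrite ler1n.
have q1 : (0 : R) < q%:R by rewrite ltr0n.
set L := (N ^ k)%N in qL hb *.
have L0 : (0 < L)%N by rewrite expn_gt0 N0.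
have LE e' : L%:R `^ e' = N%:R `^ (k%:R * e') :> R.
  by rewrite natrX -powR_mulrn ?(ltW N1)// -powRrM.
pose A := D * N%:R `^ (k%:R * e2).
have A0 : 0 < A by rewrite mulr_gt0 ?powR_gt0.
have M : mulsum N k (fun l => (~~ (q %| l)%N)%:R * linsum N (l%:R * (a%:R / q%:R + b))) <=
    A ^+ k * (8 / e1' * ((L + q)%N%:R / N%:R) * q%:R `^ e1').
  apply: le_trans (mulsum_le_sum (A := A) N0 _ _) _.
  - by move=> l; rewrite mulr_ge0 ?linsum_ge0.
  - move=> l /andP[l0 lL]; apply: le_trans (HD l l0) _.
    rewrite ler_pM2l// -LE; apply: ge0_ler_powR; rewrite ?nnegrE ?(ltW e2p)//.
    by rewrite ler_nat.
  apply: ler_wpM2l; first by rewrite exprn_ge0 ?ltW.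
  have e01 : 0 < e1' <= 1 by rewrite e1p.
  apply: le_trans (sum_linsum_nondvd_le q0 aq N0 hb e01).
  rewrite [leRHS]big_mkcond/=; apply: ler_sum => l _.
  by case: ifP => _; rewrite ?mul1r ?mul0r.
have Lq : (L + q)%N%:R <= 3 * L%:R :> R by rewrite -natrM ler_nat mulSn leq_add2l.
have qe : q%:R `^ e1' <= 2 * N%:R `^ (k%:R * e1').
  rewrite -LE; apply: (@le_trans _ _ ((2 * L%:R) `^ e1')).
    apply: ge0_ler_powR; rewrite ?nnegrE ?(ltW e1p) ?mulr_ge0//.
    by rewrite -natrM ler_nat.
  rewrite powRM//; apply: ler_wpM2r; first exact: powR_ge0.
  by apply: ler1_powR => //; rewrite ler1n.
have Nk : (0 : R) < N%:R ^- k by rewrite invr_gt0 exprn_gt0.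
apply: le_trans (ler_wpM2l (ltW Nk) M) _.
have AE : A ^+ k = D ^+ k * N%:R `^ (k%:R * e2 * k%:R).
  by rewrite exprMn -(powR_mulrn k (powR_ge0 N%:R _)) -powRrM.
have h : 8 / e1' * ((L + q)%N%:R / N%:R) * q%:R `^ e1' <=
    8 / e1' * (3 * L%:R / N%:R) * (2 * N%:R `^ (k%:R * e1')).
  apply: ler_pM; rewrite ?powR_ge0 ?mulr_ge0 ?invr_ge0 ?(ltW e1p) ?(ltW N1)//.
  apply: ler_wpM2l; first by rewrite divr_ge0 ?(ltW e1p).
  by apply: ler_wpM2r Lq; rewrite invr_ge0.
have Ak0 : 0 <= A ^+ k by rewrite exprn_ge0 ?ltW.
apply: le_trans (ler_wpM2l (ltW Nk) (ler_wpM2l Ak0 h)) _.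
have -> : N%:R ^- k * (A ^+ k * (8 / e1' * (3 * L%:R / N%:R) * (2 * N%:R `^ (k%:R * e1')))) =
   D ^+ k * (48 / e1') * (N%:R `^ (k%:R * e2 * k%:R) * N%:R `^ (k%:R * e1') * N%:R^-1).
  rewrite AE natrX; field; rewrite ?expf_eq0 !gt_eqF ?andbF//.
apply: ler_wpM2l; first by rewrite !mulr_ge0 ?exprn_ge0 ?invr_ge0 ?(ltW D0) ?(ltW e1p).
rewrite -powRD_gt0// [leRHS]powRD_gt0// powR_inv1 ?(ltW N1)//.
apply: ler_wpM2r; first by rewrite invr_ge0.
by apply: ler_powR => //; lra.
Qed.

(** No power of [N] is lost here: divisibility by [q] saves [q^-1], the decay of [linsum] in [b] is
    kept, and only the [k]-th power of the number of divisors of [q] is paid. *)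
Lemma mulsum_linsum_dvd_le (k : nat) :
  exists2 C : R, 0 < C & forall (N a q : nat) b, (0 < N)%N ->
    (0 < q)%N -> `|b| * (2 * q%:R * (N ^ k)%N%:R) <= 1 ->
    N%:R ^- k * mulsum N k (fun l => (q %| l)%N%:R *
      linsum N (l%:R * (a%:R / q%:R + b))) <=
    C * (q%:R * (1 + N%:R ^+ k.+1 * `|b|)) `^ (- (3 / 4)).
Proof.
have k10 : (0 : R) < k.+1%:R by rewrite ltr0n.
(* Chosen so that the [k]-th power of the divisor bound is at most a constant times [q^(1/4)]. *)
pose e2 : R := 4^-1 / k.+1%:R.
have e2p : 0 < e2 by rewrite divr_gt0 ?invr_gt0.
have [D D0 HD] := size_divisors_le_powR e2p.
exists (D ^+ k * 8 ^+ k * 2); first by rewrite !mulr_gt0 ?exprn_gt0.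
move=> N a q b N0 q0 hb.
have N1 : (0 : R) < N%:R by rewrite ltr0n.
have q1 : (0 : R) < q%:R by rewrite ltr0n.
have q2 : (1 : R) <= q%:R by rewrite ler1n.
have Nk : (0 : R) < N%:R ^- k by rewrite invr_gt0 exprn_gt0.
set tau : R := (size (divisors q))%:R.
have tauk : tau ^+ k <= D ^+ k * q%:R `^ (4^-1).
  apply: (@le_trans _ _ ((D * q%:R `^ e2) ^+ k)).
    by rewrite lerXn2r ?nnegrE ?mulr_ge0 ?powR_ge0 ?(ltW D0)//; exact: HD.
  rewrite exprMn; apply: ler_wpM2l; first by rewrite exprn_ge0 ?ltW.
  rewrite -powR_mulrn ?powR_ge0// -powRrM; apply: ler_powR => //.
  by rewrite /e2 mulrAC ler_pdivrMr// ler_wpM2l// ler_nat.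
set B := N%:R ^+ k.+1 * `|b|.
have B0 : 0 <= B by rewrite mulr_ge0 ?exprn_ge0 ?(ltW N1).
(* Any majorant of the form [s l^(e-1)] on the multiples of [q] can be fed into [mulsum_dvd_le]; it
   remains to choose [e] and [s]. *)
have main (e s : R) : 0 < e <= 1 -> 2 / e <= 8 -> 0 <= s ->
    (forall l, (0 < l <= N ^ k)%N -> (q %| l)%N ->
       linsum N (l%:R * (a%:R / q%:R + b)) <= s * l%:R `^ (e - 1)) ->
    N%:R ^- k * (N%:R `^ e) ^+ k * s <= 2 * (1 + B) `^ (- (3 / 4)) ->
    N%:R ^- k * mulsum N k (fun l => (q %| l)%N%:R *
      linsum N (l%:R * (a%:R / q%:R + b))) <=
    D ^+ k * 8 ^+ k * 2 * (q%:R * (1 + B)) `^ (- (3 / 4)).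
  move=> e01 e8 s0 hl hs; have /andP[e0 _] := e01.
  apply: (@le_trans _ _ (N%:R ^- k * (s *
      mulsum N k (fun l => (q %| 1 * l)%N%:R * l%:R `^ (e - 1))))).
    apply: ler_wpM2l; first exact: ltW.
    rewrite -mulsumZ; apply: le_mulsum => l lL; rewrite mul1n.
    case: (boolP (q %| l)%N) => ql; last by rewrite !mul0r mulr0.
    by rewrite !mul1r; apply: hl.
  have h := mulsum_dvd_le N k q0 (ltn0Sn 0) e01.
  apply: le_trans (ler_wpM2l (ltW Nk) (ler_wpM2l s0 h)) _.
  rewrite -/tau exprMn (exprMn k tau).
  have h2 : tau ^+ k * (2 / e) ^+ k <= D ^+ k * q%:R `^ (4^-1) * 8 ^+ k.
    apply: ler_pM => //; rewrite ?exprn_ge0 ?divr_ge0 ?(ltW e0)//.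
    by rewrite lerXn2r ?nnegrE ?divr_ge0 ?(ltW e0).
  have h3 : 0 <= N%:R ^- k * (N%:R `^ e) ^+ k * s.
    by rewrite !mulr_ge0 ?exprn_ge0 ?powR_ge0 ?(ltW Nk).
  have h4 : 0 <= tau ^+ k * (2 / e) ^+ k.
    by rewrite mulr_ge0 ?exprn_ge0 ?divr_ge0 ?(ltW e0).
  have h5 := ler_pM h4 h3 h2 hs.
  have qi : (0 : R) <= q%:R^-1 by rewrite invr_ge0.
  have := ler_wpM2r qi h5.
  have -> : tau ^+ k * (2 / e) ^+ k * (N%:R ^- k * (N%:R `^ e) ^+ k * s) / q%:R =
     N%:R ^- k * (s * (tau ^+ k * (2 / e) ^+ k * (N%:R `^ e) ^+ k * (1%:R / q%:R))).
    ring.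
  move/le_trans; apply.
  have -> : q%:R `^ (4^-1) = q%:R * q%:R `^ (- (3 / 4)) :> R.
    by rewrite -{2}(powRr1 (ltW q1)) -powRD_gt0//; congr (_ `^ _); lra.
  rewrite powRM ?(ltW q1) ?addr_ge0// le_eqVlt; apply/orP; left; apply/eqP.
  by field; rewrite gt_eqF.
have NkE e : (N%:R `^ e) ^+ k = N%:R `^ (e * k%:R) :> R.
  by rewrite -powR_mulrn ?powR_ge0// -powRrM.
have B1 : 0 < 1 + B by lra.
(* For [B <= 1] the trivial bound [linsum <= 1] suffices, with [e = 1]. Otherwise [e = 1/4], and the
   powers of [N] combine with [|b|] to exactly [B^(-3/4)]. *)
have [Bl|Bl] := leP B 1.
  apply: (main 1 1); rewrite ?ltr01 ?lexx//; first by lra.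
  - by move=> l _ _; rewrite subrr powRr0 mulr1 linsum_le1.
  rewrite mulr1 powRr1 ?(ltW N1)// mulVf ?expf_neq0 ?gt_eqF//.
  have : (2 : R) `^ (- (3 / 4)) <= (1 + B) `^ (- (3 / 4)).
    rewrite !powRN lef_pV2 ?posrE ?powR_gt0//.
    by apply: ge0_ler_powR; rewrite ?nnegrE ?(ltW B1)//; lra.
  have : (2 : R)^-1 <= 2 `^ (- (3 / 4)).
    by rewrite -powR_inv1//; apply: ler_powR; lra.
  lra.
have b0 : b != 0.
  by apply: contraTneq Bl => bE; rewrite /B bE normr0 mulr0 -leNgt.
apply: (main 4^-1 ((N%:R * `|b|) `^ (- (3 / 4)))); [lra|lra|exact: powR_ge0| |].
  move=> l lL ql; have -> : (4^-1 - 1 : R) = - (3 / 4) by lra.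
  by apply: linsum_dvd_le lL hb ql b0 _ => //; lra.
have -> : N%:R ^- k * (N%:R `^ 4^-1) ^+ k * (N%:R * `|b|) `^ (- (3 / 4)) = B `^ (- (3 / 4)).
  rewrite /B !powRM ?exprn_ge0 ?(ltW N1)// mulrA; congr (_ * _).
  rewrite NkE -powR_invn ?(ltW N1)// -!powRD_gt0// -powR_mulrn ?(ltW N1)// -powRrM.
  by congr (_ `^ _); rewrite -[k.+1%:R]natr1; lra.
have : (2 * B) `^ (- (3 / 4)) <= (1 + B) `^ (- (3 / 4)).
  rewrite !powRN lef_pV2 ?posrE ?powR_gt0//; last by lra.
  by apply: ge0_ler_powR; rewrite ?nnegrE; lra.
rewrite powRM//.
have : (2 : R)^-1 <= 2 `^ (- (3 / 4)).
  by rewrite -powR_inv1//; apply: ler_powR; lra.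
have := powR_ge0 B (- (3 / 4)); move: (B `^ _) (2 `^ _) ((1 + B) `^ _) => x y z x0 hy.
by have := ler_wpM2r x0 hy; lra.
Qed.

Lemma weyl_inequality (k : nat) e : 0 < e <= 1 ->
  exists2 C : R, 0 < C & forall (N a q : nat) b (phi : nat -> R), (0 < N)%N ->
    (0 < q <= 2 * N ^ k)%N -> coprime a q -> `|b| * (2 * q%:R * (N ^ k)%N%:R) <= 1 ->
    polyphase k (a%:R / q%:R + b) phi ->
    (N%:R^-1 * normc (\sum_(0 <= x < N) expi (phi x))) ^+ (2 ^ k) <=
    C * (N%:R `^ (e - 1) + (q%:R * (1 + N%:R ^+ k.+1 * `|b|)) `^ (- (3 / 4))).
Proof.
move=> e01; have /andP[e0 e1] := e01.
have [C1 C10 W] := weyl_differencing R k.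
have [C2 C20 M2] := mulsum_linsum_nondvd_le k e01.
have [C3 C30 M3] := mulsum_linsum_dvd_le k.
exists (C1 * (1 + C2 + C3)); first by rewrite mulr_gt0// !addr_gt0.
move=> N a q b phi N0 qL aq hb hphi; have /andP[q0 _] := qL.
have N1 : (0 : R) < N%:R by rewrite ltr0n.
apply: le_trans (W N N _ _ N0 (leqnn N) hphi) _.
rewrite -mulrA ler_pM2l//.
have -> : mulsum N k (fun l => linsum N (l%:R * (a%:R / q%:R + b))) =
    mulsum N k (fun l => (~~ (q %| l)%N)%:R * linsum N (l%:R * (a%:R / q%:R + b))) +
    mulsum N k (fun l => (q %| l)%N%:R * linsum N (l%:R * (a%:R / q%:R + b))).
  rewrite -mulsumD; apply: eq_mulsum => l.
  by case: (q %| l)%N; rewrite !(mul0r, mul1r) ?add0r ?addr0.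
have h2 := M2 N a q b N0 qL aq hb; have h3 := M3 N a q b N0 q0 hb.
have h1 : N%:R^-1 <= N%:R `^ (e - 1).
  by rewrite -powR_inv1 ?(ltW N1)//; apply: ler_powR; [rewrite ler1n|lra].
rewrite mulrDr; move: h1 h2 h3.
have := mulr_ge0 (ltW C30) (powR_ge0 N%:R (e - 1)).
have := mulr_ge0 (ltW C20) (powR_ge0 (q%:R * (1 + N%:R ^+ k.+1 * `|b|)) (- (3 / 4))).
have := powR_ge0 (q%:R * (1 + N%:R ^+ k.+1 * `|b|)) (- (3 / 4)).
move: (_ `^ (- (3 / 4))) (N%:R `^ (e - 1)) (N%:R^-1) => x y z.
move: (_ * mulsum _ _ _) (_ * mulsum _ _ _) => u v.
lra.
Qed.

End WeylBound.

(** * Moments of the exponential sum *)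

Section MomentBound.
Variable R : realType.
Implicit Types (x y : R).

Definition expsum (d N : nat) x : R :=
  N%:R^-1 * normc (\sum_(1 <= j < N.+1) expi (x * j%:R ^+ d)).

Lemma expsum_ge0 d N x : 0 <= expsum d N x.
Proof. by rewrite mulr_ge0 ?invr_ge0 ?normc_ge0. Qed.

Lemma expsum_le1 d N x : expsum d N x <= 1.
Proof.
have [->|N0] := posnP N; first by rewrite /expsum invr0 mul0r.
rewrite /expsum mulrC ler_pdivrMr ?ltr0n// mul1r.
apply: le_trans (normc_sum _ _ _) _; under eq_bigr do rewrite normc_expi.
by rewrite sumr_const_nat subn1.
Qed.

Lemma powRD_le2 x y (r : R) : 0 <= r -> 0 <= x -> 0 <= y ->
  (x + y) `^ r <= 2 `^ r * (x `^ r + y `^ r).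
Proof.
move=> r0; wlog xy : x y / x <= y => [W x0 y0|x0 y0].
  have [xy|/ltW xy] := leP x y; first exact: W.
  by rewrite (addrC x) (addrC (x `^ r)); exact: W.
apply: (@le_trans _ _ ((2 * y) `^ r)).
  by apply: ge0_ler_powR; rewrite ?nnegrE ?addr_ge0 ?mulr_ge0//; lra.
rewrite powRM//; apply: ler_wpM2l; first exact: powR_ge0.
by rewrite lerDr powR_ge0.
Qed.

(** Differencing [x^(k+1) t / M] leaves the coefficient [(k+1)! t / M], so this is the number to
    approximate. The bound on [a] confines the pairs [(q, a)] to a finite set over which the right
    side is summed later. *)
Lemma expsum_rational_approx_le (k : nat) : (1 < k)%N ->
  exists2 C : R, 0 < C & forall N M t : nat, (0 < N)%N -> (t < M)%N ->
  exists q a : nat, [/\ (0 < q <= 2 * N ^ k)%N, (a <= (k.+1)`! * q + 1)%N &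
    expsum k.+1 N (t%:R / M%:R) ^+ (k.+1 * (2 ^ k).+1) <=
    C * (N%:R ^- k.+1 + q%:R `^ (- (9 / 4)) *
      (1 + N%:R ^+ k.+1 * `|(k.+1)`!%:R * t%:R / M%:R - a%:R / q%:R|) ^- 2)].
Proof.
move=> k2; pose K : R := (2 ^ k)%N%:R.
have K0 : 0 < K by rewrite ltr0n expn_gt0.
have K1 : 0 < K + 1 by lra.
have k3 : (3 : R) <= k.+1%:R by rewrite ler_nat ltnS.
pose e : R := (K + 1)^-1.
have e01 : 0 < e <= 1 by rewrite invr_gt0 K1 invf_le1//; lra.
have [C C0 W] := weyl_inequality k e01.
(* The moment exponent divided by [2 ^ k]. With [e] as above, [(e - 1) rho = -(k + 1)]. *)
pose rho := k.+1%:R * ((K + 1) / K).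
have rho3 : 3 <= rho.
  have : 1 <= (K + 1) / K by rewrite ler_pdivlMr// mul1r; lra.
  rewrite /rho; nra.
have rho0 : 0 <= rho by lra.
exists (C `^ rho * 2 `^ rho); first by rewrite mulr_gt0 ?powR_gt0.
move=> N M t N0 tM; have M0 : (0 < M)%N by exact: leq_ltn_trans tM.
have N1 : (0 : R) < N%:R by rewrite ltr0n.
have M1 : (0 : R) < M%:R by rewrite ltr0n.
have D0 : (0 < 2 * N ^ k)%N by rewrite muln_gt0 expn_gt0 N0.
have [q [a [qD aq hi lo]]] := dirichlet_approx ((k.+1)`! * t) M0 D0.
have /andP[q0 _] := qD.
have q1 : (0 : R) < q%:R by rewrite ltr0n.
have q2 : (1 : R) <= q%:R by rewrite ler1n.
exists q, a; split => //.
  move: lo; set D := (2 * N ^ k)%N in D0 *; set f := (k.+1)`!.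
  have h1 : (q * (f * t) <= f * q * M)%N.
    by rewrite mulnCA mulnA leq_mul2l ltnW ?orbT.
  have h2 : (M <= D * M)%N by rewrite leq_pmull.
  move=> h; have : (D * (a * M) <= D * ((f * q + 1) * M))%N.
    apply: (leq_trans h); rewrite mulnDl mul1n mulnDr; apply: leq_add => //.
    by rewrite leq_mul2l h1 orbT.
  by rewrite leq_pmul2l// leq_pmul2r.
set b := _ / _ - _ / _.
have bE : b * (q%:R * M%:R) = (q * ((k.+1)`! * t))%N%:R - (a * M)%N%:R.
  by rewrite /b !natrM; field; rewrite !gt_eqF.
have hb : `|b| * (2 * q%:R * (N ^ k)%N%:R) <= 1.
  have -> : 2 * q%:R * (N ^ k)%N%:R = q%:R * (2 * N ^ k)%N%:R :> R.
    by rewrite natrM; ring.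
  rewrite -(ler_pM2r M1) mul1r.
  have -> : `|b| * (q%:R * (2 * N ^ k)%N%:R) * M%:R =
      (2 * N ^ k)%N%:R * `|b * (q%:R * M%:R)|.
    by rewrite !normrM (ger0_norm (ltW q1)) (ger0_norm (ltW M1)); ring.
  rewrite bE; move: hi lo; move: (2 * N ^ k)%N => D hi lo.
  move: hi lo; rewrite -!(ler_nat R) !natrD !(natrM R D).
  have D1 : (0 : R) <= D%:R by [].
  set U : R := (q * _)%N%:R; set V : R := (a * M)%N%:R => hi lo.
  rewrite -{1}(ger0_norm D1) -normrM ler_norml; apply/andP; split; lra.
have hphi : polyphase k (a%:R / q%:R + b)
    (fun j => t%:R / M%:R * (j + 1)%N%:R ^+ k.+1).
  have -> : a%:R / q%:R + b = t%:R / M%:R * (k.+1)`!%:R by rewrite /b; ring.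
  exact: (polyphaseZ _ (polyphase_shift 1 (polyphaseXn R k))).
have := W N a q b _ N0 qD aq hb hphi.
set B := N%:R ^+ k.+1 * `|b|.
have B0 : 0 <= B by rewrite mulr_ge0 ?exprn_ge0 ?(ltW N1).
have -> : N%:R^-1 * normc (\sum_(0 <= j < N) expi (t%:R / M%:R * (j + 1)%N%:R ^+ k.+1)) =
    expsum k.+1 N (t%:R / M%:R).
  rewrite /expsum big_add1/=; congr (_ * normc _).
  by apply: eq_bigr => i _; rewrite addn1.
set X := expsum _ _ _; have X0 : 0 <= X by exact: expsum_ge0.
set Y := (q%:R * (1 + B)) `^ _; have Y0 : 0 <= Y by exact: powR_ge0.
move=> hX.
have -> : X ^+ (k.+1 * (2 ^ k).+1) = (X ^+ (2 ^ k)) `^ rho.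
  rewrite -!powR_mulrn// -powRrM; congr (_ `^ _).
  by rewrite natrM -natr1 -/K /rho; field; rewrite gt_eqF.
have Ne0 := powR_ge0 N%:R (e - 1).
apply: le_trans (_ : (C * (N%:R `^ (e - 1) + Y)) `^ rho <= _).
  apply: ge0_ler_powR => //; rewrite nnegrE; first exact: exprn_ge0.
  by rewrite mulr_ge0 ?addr_ge0 ?(ltW C0).
rewrite powRM ?(ltW C0) ?addr_ge0// -mulrA; apply: ler_wpM2l; first exact: powR_ge0.
apply: le_trans (powRD_le2 rho0 Ne0 Y0) _.
apply: ler_wpM2l; first exact: powR_ge0.
apply: lerD.
  rewrite -powRrM -powR_invn ?(ltW N1)// le_eqVlt; apply/orP; left; apply/eqP.
  by congr (_ `^ _); rewrite /e /rho; field; rewrite !gt_eqF.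
(* With base at least 1, the exponent [-3 rho / 4] may be weakened to [-9/4], and on [1 + B] further
   to [-2]. *)
have QB : 1 <= q%:R * (1 + B) by nra.
rewrite /Y -powRrM.
apply: (@le_trans _ _ ((q%:R * (1 + B)) `^ (- (9 / 4)))).
  by apply: ler_powR => //; lra.
rewrite powRM ?(ltW q1) ?addr_ge0//; apply: ler_wpM2l; first exact: powR_ge0.
rewrite -powR_invn ?addr_ge0//; apply: ler_powR; last by lra.
by rewrite lerDl.
Qed.

(** For fixed [a / q] the sum over [t] is at most [4 M / N]. There are at most [3 f q] values of
    [a], and the remaining sum of [q^(-5/4)] is at most 5, whence [60 = 4 * 3 * 5]. In the
    application the power [N ^ (k + 1)] takes the place of [N]. *)
Lemma sum_rational_approx_le (f N M Q : nat) : (0 < f)%N -> (0 < N)%N -> (f * N <= M)%N ->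
  \sum_(1 <= q < Q.+1) \sum_(0 <= a < (f * q + 1).+1) \sum_(0 <= t < M)
    (q%:R `^ (- (9 / 4)) *
     (1 + N%:R * `|f%:R * t%:R / M%:R - a%:R / q%:R|) ^- 2) <=
  60 * f%:R * (M%:R / N%:R) :> R.
Proof.
move=> f0 N0 NM.
have f1 : (0 : R) < f%:R by rewrite ltr0n.
have f2 : (1 : R) <= f%:R by rewrite ler1n.
have N1 : (0 : R) < N%:R by rewrite ltr0n.
have M0 : (0 < M)%N by apply: leq_trans NM; rewrite muln_gt0 f0.
have M1 : (0 : R) < M%:R by rewrite ltr0n.
(* The spacing [f / M] of the points measured in units of the peak width [1 / N]; [f * N <= M] says
   that it is at most 1. *)
pose u : R := N%:R * f%:R / M%:R.
have u0 : 0 < u by rewrite divr_gt0 ?mulr_gt0.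
have u1 : u <= 1 by rewrite ler_pdivrMr// mul1r -natrM ler_nat mulnC.
have ui : 4 / u <= 4 * (M%:R / N%:R).
  rewrite /u !invfM invrK ler_pM2l//.
  rewrite mulrC ler_pM2l// ler_piMr ?invr_ge0 ?(ltW N1)// invf_le1//.
apply: (@le_trans _ _ (\sum_(1 <= q < Q.+1)
    (12 * f%:R * (M%:R / N%:R)) * q%:R `^ (- (1 + 4^-1)))); last first.
  rewrite -mulr_sumr.
  have e4 : (0 : R) < 4^-1 by rewrite invr_gt0.
  have := sum_powRN1_le Q e4; rewrite invrK => h.
  apply: le_trans (ler_wpM2l _ h) _.
    by rewrite !mulr_ge0 ?invr_ge0 ?(ltW f1) ?(ltW M1) ?(ltW N1).
  lra.
apply: ler_sum_nat => q /andP[q0 _].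
have q1 : (0 : R) < q%:R by rewrite ltr0n.
have inner (a : nat) : \sum_(0 <= t < M) (q%:R `^ (- (9 / 4)) *
     (1 + N%:R * `|f%:R * t%:R / M%:R - a%:R / q%:R|) ^- 2) <=
     q%:R `^ (- (9 / 4)) * (4 * (M%:R / N%:R)) :> R.
  rewrite -mulr_sumr; apply: ler_wpM2l; first exact: powR_ge0.
  apply: le_trans ui.
  pose c : R := a%:R * M%:R / (q%:R * f%:R).
  have c0 : 0 <= c by rewrite divr_ge0 ?mulr_ge0 ?(ltW M1) ?(ltW q1) ?(ltW f1).
  have u01 : 0 < u <= 1 by rewrite u0.
  apply: le_trans (sum_invSqr_dist_le M u01 c0).
  apply: ler_sum => t _; rewrite le_eqVlt; apply/orP; left; apply/eqP.
  congr ((1 + _) ^- 2).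
  have -> : f%:R * t%:R / M%:R - a%:R / q%:R = f%:R / M%:R * (t%:R - c).
    by rewrite /c; field; rewrite !gt_eqF.
  rewrite normrM ger0_norm; last by rewrite divr_ge0 ?(ltW f1) ?(ltW M1).
  by rewrite /u; ring.
apply: le_trans (ler_sum _ (fun a _ => inner a)) _.
rewrite sumr_const_nat subn0 -[leLHS]mulr_natl.
have -> : q%:R `^ (- (9 / 4)) = q%:R `^ (- (1 + 4^-1)) / q%:R :> R.
  by rewrite -[q%:R^-1]powR_inv1 ?(ltW q1)// -powRD_gt0//; congr (_ `^ _); lra.
have h : (f * q + 1).+1%:R <= 3 * f%:R * q%:R :> R.
  have fq : (0 < f * q)%N by rewrite muln_gt0 f0.
  by rewrite -!natrM ler_nat -mulnA; move: (f * q)%N fq => n; lia.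
have P0 := powR_ge0 (q%:R : R) (- (1 + 4^-1)).
have MN : 0 <= M%:R / N%:R :> R by rewrite divr_ge0 ?(ltW M1) ?(ltW N1).
apply: le_trans (ler_wpM2r _ h) _.
  by rewrite !mulr_ge0 ?invr_ge0 ?(ltW q1) ?(ltW M1) ?(ltW N1).
rewrite le_eqVlt; apply/orP; left; apply/eqP.
by field; rewrite !gt_eqF.
Qed.

(** The pair [(q, a)] belonging to [t] need not be followed: its term is bounded by the sum over all
    admissible pairs, and exchanging the sums makes this affordable. *)
Lemma expsum_moment_le (k : nat) : (1 < k)%N ->
  exists2 C : R, 0 < C & forall N M : nat, (0 < N)%N -> ((k.+1)`! * N ^ k.+1 <= M)%N ->
    \sum_(0 <= t < M) expsum k.+1 N (t%:R / M%:R) ^+ (k.+1 * (2 ^ k).+1) <=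
    C * (M%:R / N%:R ^+ k.+1).
Proof.
move=> k2; have [C C0 H] := expsum_rational_approx_le k2.
set f := (k.+1)`!; have f0 : (0 < f)%N by exact: fact_gt0.
have f1 : (0 : R) < f%:R by rewrite ltr0n.
exists (C * (1 + 60 * f%:R)); first by rewrite mulr_gt0// addr_gt0// mulr_gt0.
move=> N M N0 NM.
have NK0 : (0 < N ^ k.+1)%N by rewrite expn_gt0 N0.
pose Q := (2 * N ^ k)%N.
pose G (t q a : nat) : R := q%:R `^ (- (9 / 4)) *
     (1 + (N ^ k.+1)%N%:R * `|f%:R * t%:R / M%:R - a%:R / q%:R|) ^- 2.
have G0 t q a : 0 <= G t q a.
  by rewrite mulr_ge0 ?powR_ge0// invr_ge0 exprn_ge0// addr_ge0// mulr_ge0.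
apply: (@le_trans _ _ (\sum_(0 <= t < M) C * (N%:R ^- k.+1 +
    \sum_(1 <= q < Q.+1) \sum_(0 <= a < (f * q + 1).+1) G t q a))).
  apply: ler_sum_nat => t /andP[_ tM].
  have [q [a [/andP[q0 qQ] af h]]] := H N M t N0 tM.
  apply: le_trans h _; rewrite ler_pM2l// lerD2l.
  rewrite (bigD1_seq q) ?iota_uniq//=; last by rewrite mem_index_iota q0 ltnS.
  rewrite (bigD1_seq a) ?iota_uniq//=; last by rewrite mem_index_iota ltnS.
  rewrite -addrA {1}/G natrX lerDl addr_ge0//; first by apply: sumr_ge0.
  by apply: sumr_ge0 => i _; apply: sumr_ge0.
rewrite -mulr_sumr big_split/= -mulrA ler_pM2l// mulrDl mul1r; apply: lerD.
  by rewrite sumr_const_nat subn0 -[leLHS]mulr_natl.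
rewrite exchange_big/=; under eq_bigr do rewrite exchange_big/=.
by apply: le_trans (sum_rational_approx_le Q f0 NK0 NM) _; rewrite natrX.
Qed.

End MomentBound.

(** * Interpolation *)

Section Interpolation.
Variable R : realType.
Implicit Types (x y t p q : R) (f : nat -> R[i]).

Lemma powRVl x y : 0 < x -> x^-1 `^ y = (x `^ y)^-1.
Proof. by move=> x0; rewrite -[x^-1]powR_inv1 ?(ltW x0)// -powRrM mulN1r powRN. Qed.

Lemma powR2N_lt1 x : 0 < x -> 2 `^ (- x) < 1 :> R.
Proof.
move=> x0; rewrite /powR gt_eqF// expR_lt1 mulNr oppr_lt0 mulr_gt0// ln_gt0//; lra.
Qed.

Lemma hoelder_sum (n : nat) (a b : nat -> R) p q : 0 < p -> 0 < q -> p^-1 + q^-1 = 1 ->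
  (forall i, 0 <= a i) -> (forall i, 0 <= b i) ->
  \sum_(0 <= i < n) a i * b i <=
  (\sum_(0 <= i < n) a i `^ p) `^ p^-1 * (\sum_(0 <= i < n) b i `^ q) `^ q^-1.
Proof.
move=> p0 q0 pq a0 b0.
set A := \sum_(0 <= i < n) a i `^ p; set B := \sum_(0 <= i < n) b i `^ q.
have A0 : 0 <= A by apply: sumr_ge0 => i _; exact: powR_ge0.
have B0 : 0 <= B by apply: sumr_ge0 => i _; exact: powR_ge0.
have nul (c : nat -> R) r : 0 < r -> (forall i, 0 <= c i) ->
    \sum_(0 <= i < n) c i `^ r = 0 -> forall i, (i < n)%N -> c i = 0.
  move=> r0 c0 /eqP; rewrite big_mkord psumr_eq0; last by move=> i _; exact: powR_ge0.
  move=> /allP h i i_n; have := h (Ordinal i_n); rewrite mem_index_enum => /(_ isT)/=.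
  by rewrite powR_eq0 => /andP[/eqP].
have [AE|An] := eqVneq A 0.
  rewrite big_nat_cond big1 ?mulr_ge0 ?powR_ge0// => i /andP[/andP[_ i_n] _].
  by rewrite (nul a p)// mul0r.
have [BE|Bn] := eqVneq B 0.
  rewrite big_nat_cond big1 ?mulr_ge0 ?powR_ge0// => i /andP[/andP[_ i_n] _].
  by rewrite (nul b q)// mulr0.
have Ap : 0 < A by rewrite lt_neqAle eq_sym An.
have Bp : 0 < B by rewrite lt_neqAle eq_sym Bn.
set u := A `^ p^-1; set v := B `^ q^-1.
have u0 : 0 < u by exact: powR_gt0.
have v0 : 0 < v by exact: powR_gt0.
have up : u `^ p = A by rewrite -powRrM mulVf ?gt_eqF// powRr1.
have vq : v `^ q = B by rewrite -powRrM mulVf ?gt_eqF// powRr1.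
move: u v u0 v0 up vq => u v u0 v0 up vq.
have uv : 0 < u * v := mulr_gt0 u0 v0.
suff h : (\sum_(0 <= i < n) a i * b i) / (u * v) <= 1.
  by rewrite ler_pdivrMr// mul1r in h.
rewrite mulr_suml -[leRHS]pq.
apply: (@le_trans _ _ (\sum_(0 <= i < n) (a i `^ p / A / p + b i `^ q / B / q))).
  apply: ler_sum => i _.
  have -> : a i * b i / (u * v) = (a i / u) * (b i / v) by field; rewrite !gt_eqF.
  have := @conjugate_powR R (a i / u) (b i / v) p q
    (divr_ge0 (a0 i) (ltW u0)) (divr_ge0 (b0 i) (ltW v0)) p0 q0 pq.
  rewrite !powRM ?invr_ge0 ?(ltW u0) ?(ltW v0)//.
  by rewrite !powRVl// up vq.
by rewrite big_split/= -!mulr_suml -/A -/B !divff// !mul1r.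
Qed.

(** Only the scales below [x] count; from the first of them on, the terms decrease geometrically
    with ratio [2^-d]. The starting point [t] does not enter the bound. *)
Lemma sum_dyadic_le x t (d : R) (n : nat) : 0 < d -> 0 <= x -> 0 <= t ->
  \sum_(0 <= i < n) (if t / 2 ^+ i <= x then (t / 2 ^+ i) `^ d else 0) <=
  (1 - 2 `^ (- d))^-1 * x `^ d.
Proof.
move=> d0 x0; set c := (1 - _)^-1.
have r1 := powR2N_lt1 d0.
have c0 : 0 < c by rewrite invr_gt0 subr_gt0.
have cE : 1 + 2 `^ (- d) * c = c.
  by rewrite /c; field; rewrite subr_eq0 eq_sym lt_eqF.
pose S m s := \sum_(0 <= i < m) (if s / 2 ^+ i <= x then (s / 2 ^+ i) `^ d else 0).
have SS m s : S m.+1 s = (if s <= x then s `^ d else 0) + S m (s / 2).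
  rewrite /S big_nat_recl// expr0 divr1; congr (_ + _); apply: eq_bigr => i _.
  by rewrite exprS invfM mulrA.
have low m s : 0 <= s -> s <= x -> S m s <= c * s `^ d.
  elim: m s => [|m IHm] s s0 sx.
    by rewrite /S big_geq// mulr_ge0 ?powR_ge0 ?(ltW c0).
  rewrite SS sx; apply: (@le_trans _ _ (s `^ d + c * (s / 2) `^ d)).
    by rewrite lerD2l; apply: IHm; lra.
  rewrite powRM ?invr_ge0// -{2}cE.
  have -> : 2^-1 `^ d = 2 `^ (- d) :> R by rewrite -powR_inv1// -powRrM mulN1r.
  lra.
elim: n t => [|n IHn] t t0; first by rewrite big_geq// mulr_ge0 ?powR_ge0 ?(ltW c0).
have [tx|tx] := leP t x.
  apply: le_trans (low n.+1 t t0 tx) _; rewrite ler_pM2l//.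
  by apply: ge0_ler_powR; rewrite ?nnegrE ?(ltW d0).
rewrite -/(S n.+1 t) SS (lt_geF tx) add0r; apply: IHn; lra.
Qed.

Lemma dyadic_level t y : 0 < y -> y <= t ->
  exists n : nat, t / 2 ^+ n.+1 < y /\ y <= t / 2 ^+ n.
Proof.
move=> y0 yt; have t0 : 0 < t by exact: lt_le_trans yt.
have ex : exists n : nat, t / 2 ^+ n.+1 < y.
  exists (Num.truncn (t / y)); rewrite ltr_pdivrMr ?exprn_gt0// mulrC -ltr_pdivrMr//.
  apply: lt_le_trans (truncnS_gt _) _.
  by rewrite -natrX ler_nat; exact/ltnW/ltn_expl.
exists (ex_minn ex); case: ex_minnP => n hn hmin; split => //.
case: n hn hmin => [|n] hn hmin; first by rewrite expr0 divr1.
by rewrite leNgt; apply/negP => /hmin; rewrite ltnn.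
Qed.

(* Marcinkiewicz interpolation: where [|T f|] has size about [t / 2 ^ m], [f] is
   truncated at the height for which the [l^1 -> l^oo] bound makes the upper part
   contribute at most [t / 2 ^ m / 4]; the [l^2] bound handles the lower part. *)
Lemma interpolation_le p : 1 < p < 2 -> exists2 C : R, 0 < C &
  forall (n : nat) (T : nat -> nat -> R[i]) (L : R), 0 <= L ->
  (forall i j, normc (T i j) <= 1) ->
  (forall f, \sum_(0 <= j < n) normc (\sum_(0 <= i < n) f i * T i j) ^+ 2 <=
     L * \sum_(0 <= i < n) normc (f i) ^+ 2) ->
  forall f, \sum_(0 <= j < n) normc (\sum_(0 <= i < n) f i * T i j) `^ (p / (p - 1)) <=
    C * L * (\sum_(0 <= i < n) normc (f i) `^ p) `^ (p / (p - 1) - 1).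
Proof.
move=> /andP[p1 p2]; have pm : 0 < p - 1 by lra.
set q := p / (p - 1); pose d := q - 2.
have dE : d = (2 - p) / (p - 1) by rewrite /d /q; field; rewrite gt_eqF.
have d0 : 0 < d by rewrite dE divr_gt0//; lra.
have r1 := powR2N_lt1 d0.
set c := (1 - 2 `^ (- d))^-1.
have c0 : 0 < c by rewrite invr_gt0 subr_gt0.
exists (16 * (c * 4 `^ d)); first by rewrite !mulr_gt0 ?powR_gt0.
move=> n T L L0 T1 T2 f.
pose a i := normc (f i); have a0 i : 0 <= a i by exact: normc_ge0.
pose A := \sum_(0 <= i < n) a i `^ p.
have A0 : 0 <= A by apply: sumr_ge0 => i _; exact: powR_ge0.
(* As the entries of [T] have modulus at most 1, this [l^1] norm bounds every output; the dyadic
   levels start from it. *)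
pose t := \sum_(0 <= i < n) a i.
have t0 : 0 <= t by apply: sumr_ge0.
pose F (h : nat -> R[i]) j := normc (\sum_(0 <= i < n) h i * T i j).
have F0 h j : 0 <= F h j by exact: normc_ge0.
have Fle h j : F h j <= \sum_(0 <= i < n) normc (h i).
  apply: le_trans (normc_sum _ _ _) _; apply: ler_sum => i _.
  by rewrite normcM ler_piMr ?normc_ge0.
have [AE|An] := eqVneq A 0.
  have f0 i : (i < n)%N -> a i = 0.
    move=> i_n; move/eqP: AE; rewrite /A big_mkord psumr_eq0; last by move=> ? _; exact: powR_ge0.
    move=> /allP/(_ (Ordinal i_n)); rewrite mem_index_enum => /(_ isT)/=.
    by rewrite powR_eq0 => /andP[/eqP].
  rewrite big1 ?mulr_ge0 ?powR_ge0 ?(ltW c0)// => j _.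
  have /eqP : F f j = 0.
    apply/le_anti; rewrite F0 andbT; apply: le_trans (Fle f j) _.
    by rewrite big_nat_cond big1// => i /andP[/andP[_ i_n] _]; exact: f0.
  rewrite /F => /eqP ->; rewrite powR0// gt_eqF//; rewrite divr_gt0//; lra.
have Ap : 0 < A by rewrite lt_neqAle eq_sym An.
pose low (m : nat) i := t / 2 ^+ m * a i `^ (p - 1) <= 4 * A.
pose fl (m : nat) i := if low m i then f i else 0.
have high m j : F f j <= F (fl m) j + t / 2 ^+ m / 4.
  have tm : 0 <= t / 2 ^+ m by rewrite divr_ge0 ?exprn_ge0.
  have -> : F f j = normc (\sum_(0 <= i < n) fl m i * T i j +
      \sum_(0 <= i < n) (f i - fl m i) * T i j).
    by rewrite -big_split/=; congr normc; apply: eq_bigr => i _; ring.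
  apply: le_trans (le_normcD _ _) _; rewrite lerD2l.
  apply: le_trans (Fle (fun i => f i - fl m i) j) _.
  have -> : t / 2 ^+ m / 4 = t / 2 ^+ m / (4 * A) * A.
    by field; rewrite gt_eqF//= expf_neq0.
  rewrite /A mulr_sumr; apply: ler_sum => i _.
  rewrite /fl; case: ifPn => [_|]; first by rewrite subrr normc0 mulr_ge0 ?powR_ge0 ?divr_ge0 ?mulr_ge0.
  rewrite /low -ltNge subr0 -/(a i) => h.
  have ai : a i * a i `^ (p - 1) = a i `^ p by apply: mulr_powRB1 => //; lra.
  rewrite -ai mulrCA ler_peMr// mulrAC ler_pdivlMr ?mulr_gt0// mul1r; exact: ltW.
have level j : exists m : nat, F f j = 0 \/ t / 2 ^+ m.+1 < F f j <= t / 2 ^+ m.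
  have [E|En] := eqVneq (F f j) 0; first by exists 0%N; left.
  have Fp : 0 < F f j by rewrite lt_neqAle eq_sym En F0.
  by have [m [h1 h2]] := dyadic_level Fp (Fle f j); exists m; right; rewrite h1.
have [lev hlev] := choice level.
(* At its own level the output exceeds [t / 2^(m+1)], so the removed part accounts for less than
   half of it. Two of the [q] powers go to the truncated output, the other [d = q - 2] to the
   level. *)
have term j : F f j `^ q <= 16 * ((t / 2 ^+ lev j) `^ d * F (fl (lev j)) j ^+ 2).
  have [->|/andP[h1 h2]] := hlev j.
    rewrite powR0 ?mulr_ge0 ?powR_ge0 ?sqr_ge0// gt_eqF// divr_gt0//; lra.
  have Fp : 0 < F f j by apply: le_lt_trans h1; rewrite divr_ge0 ?exprn_ge0.
  have h3 := high (lev j) j.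
  have h4 : t / 2 ^+ lev j < 2 * F f j.
    by move: h1; rewrite exprS invfM mulrCA -ltr_pdivlMl ?invr_gt0// invrK.
  have h5 : F f j <= 4 * F (fl (lev j)) j by lra.
  have -> : q = 2%:R + d by rewrite /d; lra.
  rewrite powRD_gt0// powR_mulrn//.
  have h6 : F f j `^ d <= (t / 2 ^+ lev j) `^ d.
    by apply: ge0_ler_powR; rewrite ?nnegrE ?(ltW d0)// (le_trans _ h2).
  have h7 : F f j ^+ 2 <= 16 * F (fl (lev j)) j ^+ 2.
    have -> : 16 * F (fl (lev j)) j ^+ 2 = (4 * F (fl (lev j)) j) ^+ 2 by ring.
    by rewrite ler_pXn2r// ?nnegrE ?mulr_ge0.
  have := ler_pM (sqr_ge0 _) (powR_ge0 _ _) h7 h6; lra.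
pose K := (\max_(j < n) lev j).+1.
have levK j : (j < n)%N -> (lev j < K)%N.
  by move=> jn; rewrite ltnS (leq_bigmax (Ordinal jn)).
(* Allowing every level for every [j] decouples [m] from [j], so that the [l^2] bound applies to
   each truncation [fl m]. *)
apply: (@le_trans _ _ (\sum_(0 <= j < n) \sum_(0 <= m < K)
    16 * ((t / 2 ^+ m) `^ d * F (fl m) j ^+ 2))).
  apply: ler_sum_nat => j /andP[_ jn]; apply: le_trans (term j) _.
  rewrite (bigD1_seq (lev j)) ?iota_uniq ?mem_index_iota ?levK//= lerDl.
  by apply: sumr_ge0 => m _; rewrite !mulr_ge0 ?powR_ge0 ?sqr_ge0.
rewrite exchange_big/=.
apply: (@le_trans _ _ (\sum_(0 <= m < K) 16 * L * \sum_(0 <= i < n)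
    a i ^+ 2 * (if low m i then (t / 2 ^+ m) `^ d else 0))).
  apply: ler_sum => m _; rewrite -mulr_sumr -mulrA ler_pM2l// -mulr_sumr.
  apply: le_trans (ler_wpM2l (powR_ge0 _ _) (T2 (fl m))) _.
  rewrite mulrCA; apply: ler_wpM2l => //; rewrite mulr_sumr; apply: ler_sum => i _.
  rewrite /fl; case: ifP => _; first by rewrite mulrC.
  by rewrite normc0 expr0n mulr0 mulr0.
rewrite -mulr_sumr exchange_big/=.
have -> : 16 * (c * 4 `^ d) * L * A `^ (q - 1) = 16 * L * (c * 4 `^ d * A `^ (q - 1)) by ring.
apply: ler_wpM2l; first by rewrite mulr_ge0.
have -> : c * 4 `^ d * A `^ (q - 1) = \sum_(0 <= i < n) c * 4 `^ d * A `^ d * a i `^ p.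
  have -> : q - 1 = d + 1 by rewrite /d; lra.
  by rewrite -mulr_sumr -/A (powRD_gt0 d 1 Ap) powRr1 ?(ltW Ap)// !mulrA.
apply: ler_sum => i _; rewrite -mulr_sumr.
have [->|an] := eqVneq (a i) 0.
  by rewrite expr0n mul0r powR0 ?mulr0// gt_eqF//; lra.
have ap : 0 < a i by rewrite lt_neqAle eq_sym an a0.
(* The largest level at which [f i] is kept. The final powers match because [2 + (1 - p) d = p]. *)
pose x := 4 * A * a i `^ (1 - p).
have x0 : 0 <= x by rewrite !mulr_ge0 ?powR_ge0 ?(ltW Ap).
have aux : a i `^ (1 - p) * a i `^ (p - 1) = 1.
  by rewrite -powRD_gt0// [_ + _](_ : _ = 0) ?powRr0//; ring.
have lowE m : low m i = (t / 2 ^+ m <= x).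
  have xE : x * a i `^ (p - 1) = 4 * A by rewrite /x -mulrA aux mulr1.
  by rewrite /low -[RHS](ler_pM2r (powR_gt0 (p - 1) ap)) xE.
under eq_bigr do rewrite lowE.
apply: le_trans (ler_wpM2l (sqr_ge0 _) (sum_dyadic_le K d0 x0 t0)) _.
rewrite -/c /x powRM ?powR_ge0 ?mulr_ge0 ?(ltW Ap)// powRM ?(ltW Ap)// -powRrM.
rewrite le_eqVlt; apply/orP; left; apply/eqP.
have -> : a i `^ p = a i ^+ 2 * a i `^ ((1 - p) * d).
  rewrite -powR_mulrn// -powRD_gt0//; congr (_ `^ _); rewrite dE; field.
  by rewrite gt_eqF.
ring.
Qed.

End Interpolation.

(** * Fourier analysis on a cyclic group *)

Section CyclicFourier.
Variable R : realType.
Implicit Types (p : R) (f : nat -> R[i]) (F : nat -> R).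

Lemma sum_expi_orth (M r z : nat) : (r < M)%N -> (z < M)%N ->
  \sum_(0 <= t < M) expi (t%:R * ((r%:R - z%:R) / M%:R) : R) =
  if r == z then M%:R else 0.
Proof.
move=> rM zM; have M0 : (0 : R) < M%:R by rewrite ltr0n (leq_ltn_trans _ rM).
have [->|rz] := eqVneq r z.
  under eq_bigr do rewrite subrr mul0r mulr0 expi0.
  by rewrite sumr_const_nat subn0.
set x := (_ / _ : R).
under eq_bigr do rewrite mulrC expiXn.
have h : (expi x - 1) * \sum_(0 <= t < M) expi x ^+ t = 0.
  rewrite big_mkord -subrX1 -expiXn /x mulfVK ?gt_eqF//.
  by rewrite expiD expiN !expi_nat conjc1 mulr1 subrr.
have lt1 (a b : nat) : (a < b)%N -> (b < M)%N -> expi ((b%:R - a%:R) / M%:R : R) != 1.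
  move=> ab bM; apply/eqP => e.
  have x0 : 0 < (b%:R - a%:R) / M%:R :> R by rewrite divr_gt0// subr_gt0 ltr_nat.
  have x1 : (b%:R - a%:R) / M%:R < 1 :> R.
    rewrite ltr_pdivrMr// mul1r -natrB ?(ltnW ab)// ltr_nat.
    exact: leq_ltn_trans (leq_subr _ _) bM.
  have := @normc_1Bexpi_ge R ((b%:R - a%:R) / M%:R).
  rewrite e subrr normc0 (ltW x0) (ltW x1) => /(_ isT).
  by rewrite leNgt mulr_gt0// mulr_gt0// subr_gt0.
have xn1 : expi x != 1.
  move: rz; rewrite neq_ltn => /orP[rz|zr]; last exact: lt1.
  have -> : x = - ((z%:R - r%:R) / M%:R) by rewrite /x -mulNr opprB.
  rewrite expiN; apply: contra (lt1 _ _ rz zM) => /eqP e.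
  by rewrite -[expi _]conjcK e conjc1.
by apply/eqP; move/eqP: h; rewrite mulf_eq0 subr_eq0 (negPf xn1).
Qed.

Lemma expi_modn (M t y : nat) : (0 < M)%N ->
  expi (t%:R * y%:R / M%:R : R) = expi (t%:R * (y %% M)%N%:R / M%:R).
Proof.
move=> M0; have M1 : (M%:R : R) != 0 by rewrite pnatr_eq0 -lt0n.
rewrite -[RHS](expiDn _ (t * (y %/ M))); congr expi.
by rewrite {1}(divn_eq y M) natrD !natrM; field.
Qed.

Lemma parseval (M : nat) f : (0 < M)%N ->
  \sum_(0 <= t < M) normc (\sum_(0 <= y < M) f y * expi (y%:R * t%:R / M%:R)) ^+ 2 =
  M%:R * \sum_(0 <= y < M) normc (f y) ^+ 2.
Proof.
move=> M0; have M1 : (M%:R : R) != 0 by rewrite pnatr_eq0 -lt0n.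
apply: (@complexI R); rewrite rmorph_sum rmorphM rmorph_sum/= rmorph_nat.
have cE z : real_complex R (normc z ^+ 2) = z * conjc z by rewrite mulc_conj.
under eq_bigr do rewrite cE rmorph_sum/= mulr_suml.
under [in RHS]eq_bigr do rewrite cE.
rewrite exchange_big/= mulr_sumr; apply: eq_big_nat => y /andP[_ yM].
under eq_bigr do rewrite mulr_sumr.
rewrite exchange_big/=.
transitivity (\sum_(0 <= z < M) f y * conjc (f z) * if y == z then M%:R else 0).
  apply: eq_big_nat => z /andP[_ zM].
  rewrite -(sum_expi_orth yM zM) mulr_sumr; apply: eq_bigr => t _.
  have -> : t%:R * ((y%:R - z%:R) / M%:R) = y%:R * t%:R / M%:R + - (z%:R * t%:R / M%:R) :> R.
    by field.
  by rewrite expiD expiN rmorphM/=; ring.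
rewrite (bigD1_seq y) ?iota_uniq ?mem_index_iota//= eqxx big1 ?addr0; first by rewrite mulrC.
by move=> z zy; rewrite eq_sym (negPf zy) mulr0.
Qed.

(** Interpolation with Parseval's identity as the [l^2] bound, that is, with [L = M]. *)
Lemma hausdorff_young p : 1 < p < 2 -> exists2 C : R, 0 < C &
  forall (M : nat) f, (0 < M)%N ->
  \sum_(0 <= t < M) normc (\sum_(0 <= y < M) f y * expi (y%:R * t%:R / M%:R)) `^ (p / (p - 1)) <=
  C * M%:R * (\sum_(0 <= y < M) normc (f y) `^ p) `^ (p / (p - 1) - 1).
Proof.
move=> p12; have [C C0 H] := interpolation_le p12; exists C => // M f M0.
apply: (H M (fun y t => expi (y%:R * t%:R / M%:R)) M%:R) => //.
  by move=> i j; rewrite normc_expi.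
by move=> h; rewrite parseval.
Qed.

Definition cyclic_avg (d N M : nat) F (y : nat) : R :=
  N%:R^-1 * \sum_(1 <= k < N.+1) F ((y + k ^ d) %% M)%N.

Definition dft (M : nat) F (t : nat) : R[i] :=
  \sum_(0 <= z < M) real_complex R (F z) * conjc (expi (z%:R * t%:R / M%:R)).

Lemma normc_dft M F t : normc (dft M F t) =
  normc (\sum_(0 <= z < M) real_complex R (F z) * expi (z%:R * t%:R / M%:R)).
Proof.
rewrite -[RHS]normc_conj rmorph_sum; congr normc; apply: eq_bigr => z _.
by rewrite rmorphM; congr (_ * _); exact/esym/conjc_real.
Qed.

Lemma dft_inversion (M y : nat) F : (0 < M)%N ->
  \sum_(0 <= t < M) dft M F t * expi (t%:R * y%:R / M%:R) =
  M%:R * real_complex R (F (y %% M)%N).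
Proof.
move=> M0; have M1 : (M%:R : R) != 0 by rewrite pnatr_eq0 -lt0n.
have yM : (y %% M < M)%N by rewrite ltn_mod.
under eq_bigr do rewrite expi_modn// mulr_suml.
rewrite exchange_big.
transitivity (\sum_(0 <= z < M) real_complex R (F z) * if (y %% M)%N == z then M%:R else 0).
  apply: eq_big_nat => z /andP[_ zM].
  rewrite -(sum_expi_orth yM zM) mulr_sumr; apply: eq_bigr => t _.
  have -> : t%:R * (((y %% M)%N%:R - z%:R) / M%:R) =
     t%:R * (y %% M)%N%:R / M%:R + - (z%:R * t%:R / M%:R) :> R by field.
  by rewrite expiD expiN; ring.
rewrite (bigD1_seq (y %% M)%N) ?iota_uniq ?mem_index_iota//= eqxx big1 ?addr0.
  by rewrite mulrC.
by move=> z zy; rewrite eq_sym (negPf zy) mulr0.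
Qed.

(** The average is a convolution, hence a Fourier multiplier; inversion with the unnormalised [dft]
    leaves the factor [M]. *)
Lemma cyclic_avg_fourier (d N M y : nat) F : (0 < M)%N ->
  real_complex R (M%:R * cyclic_avg d N M F y) =
  \sum_(0 <= t < M) (dft M F t * (real_complex R N%:R^-1 *
    \sum_(1 <= k < N.+1) expi (t%:R / M%:R * k%:R ^+ d))) * expi (t%:R * y%:R / M%:R).
Proof.
move=> M0; have M1 : (M%:R : R) != 0 by rewrite pnatr_eq0 -lt0n.
transitivity (\sum_(0 <= t < M) \sum_(1 <= k < N.+1) real_complex R N%:R^-1 *
    (dft M F t * expi (t%:R * (y + k ^ d)%N%:R / M%:R))).
  rewrite exchange_big/=; under eq_bigr do rewrite -mulr_sumr dft_inversion//.
  rewrite /cyclic_avg rmorphM rmorph_nat rmorphM rmorph_sum/= -!mulr_sumr.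
  by rewrite mulrCA mulr_sumr.
apply: eq_bigr => t _; rewrite mulr_sumr mulr_sumr mulr_suml; apply: eq_bigr => k _.
have -> : t%:R * (y + k ^ d)%N%:R / M%:R = t%:R / M%:R * k%:R ^+ d + t%:R * y%:R / M%:R :> R.
  by rewrite natrD natrX; field.
by rewrite expiD; ring.
Qed.

(** Hausdorff-Young controls [dft M F] in [l^q]; Hoelder with the moment bound brings its product
    with the multiplier into [l^p]; Hausdorff-Young, applied to this product [g], returns to the
    average. *)
Lemma cyclic_avg_le (k : nat) p : (1 < k)%N -> 1 < p < 2 ->
  (k.+1 * (2 ^ k).+1)%N%:R * (2 - p) <= p ->
  exists2 C : R, 0 < C & forall (N M : nat) F, (0 < N)%N ->
    ((k.+1)`! * N ^ k.+1 <= M)%N ->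
    \sum_(0 <= y < M) `|cyclic_avg k.+1 N M F y| `^ (p / (p - 1)) <=
    C * N%:R `^ (- (k.+1%:R * ((2 - p) / (p - 1)))) *
    (\sum_(0 <= y < M) `|F y| `^ p) `^ (p / (p - 1) - 1).
Proof.
move=> k1 p12 hs; have /andP[p1 p2] := p12.
have pm : 0 < p - 1 by lra.
have pc : 0 < 2 - p by lra.
set q := p / (p - 1).
have qp : 0 < q by rewrite divr_gt0//; lra.
have qE : q - 1 = (p - 1)^-1 by rewrite /q; field; rewrite gt_eqF.
have [C1 C10 HY] := hausdorff_young p12.
have [C2 C20 MB] := expsum_moment_le R k1.
exists (C1 * (C1 `^ (p - 1) * C2 `^ (2 - p)) `^ (q - 1)).
  by rewrite mulr_gt0 ?powR_gt0// mulr_gt0 ?powR_gt0.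
move=> N M F N0 NM.
have M0 : (0 < M)%N by apply: leq_trans NM; rewrite muln_gt0 fact_gt0 expn_gt0 N0.
have M1 : (0 : R) < M%:R by rewrite ltr0n.
have N1 : (0 : R) < N%:R by rewrite ltr0n.
pose m (t : nat) := expsum k.+1 N (t%:R / M%:R : R).
have m0 t : 0 <= m t by exact: expsum_ge0.
pose g t := dft M F t * (real_complex R N%:R^-1 *
    \sum_(1 <= j < N.+1) expi (t%:R / M%:R * j%:R ^+ k.+1)).
have gE t : normc (g t) = normc (dft M F t) * m t.
  by rewrite /g !normcM normc_real ger0_norm ?invr_ge0.
set S := \sum_(0 <= y < M) `|F y| `^ p.
have S0 : 0 <= S by apply: sumr_ge0 => i _; exact: powR_ge0.
pose s := p / (2 - p).
have s0 : 0 < s by rewrite divr_gt0//; lra.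
have hsum1 : \sum_(0 <= t < M) normc (dft M F t) `^ q <= C1 * M%:R * S `^ (q - 1).
  under eq_bigr do rewrite normc_dft.
  apply: le_trans (HY M (fun z => real_complex R (F z)) M0) _.
  rewrite -/q; under eq_bigr do rewrite normc_real.
  by [].
(* The hypothesis says that [s] is at least the exponent of the moment bound; since [m t <= 1],
   raising the exponent only decreases the sum. *)
have hsum2 : \sum_(0 <= t < M) m t `^ s <= C2 * (M%:R / N%:R ^+ k.+1).
  apply: le_trans (MB N M N0 NM); apply: ler_sum => t _.
  rewrite -/(m t) -powR_mulrn//.
  have [->|mn] := eqVneq (m t) 0.
    by rewrite powR0 ?powR_ge0// gt_eqF.
  apply: ger_powR; first by rewrite lt_neqAle eq_sym mn m0 expsum_le1.
  by rewrite ler_pdivlMr.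
have hg : \sum_(0 <= t < M) normc (g t) `^ p <=
    (C1 * M%:R * S `^ (q - 1)) `^ (p - 1) * (C2 * (M%:R / N%:R ^+ k.+1)) `^ (2 - p).
  (* Hoelder with exponents [1 / (p - 1)] and [1 / (2 - p)], which turn the power [p] into [q] on
     the transform and [s] on the multiplier. *)
  have e1 : 0 < (p - 1)^-1 by rewrite invr_gt0.
  have e2 : 0 < (2 - p)^-1 by rewrite invr_gt0.
  have e12 : (p - 1)^-1^-1 + (2 - p)^-1^-1 = 1 by rewrite !invrK; lra.
  have := @hoelder_sum R M (fun t => normc (dft M F t) `^ p) (fun t => m t `^ p)
    _ _ e1 e2 e12 (fun t => powR_ge0 _ _) (fun t => powR_ge0 _ _).
  rewrite !invrK => h.
  apply: le_trans (_ : _ <= \sum_(0 <= t < M) normc (dft M F t) `^ p * m t `^ p) _.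
    by apply: ler_sum => t _; rewrite gE powRM ?normc_ge0.
  apply: le_trans h _; apply: ler_pM; rewrite ?powR_ge0//.
    apply: ge0_ler_powR; rewrite ?nnegrE ?(ltW pm)//.
    - by apply: sumr_ge0 => t _; exact: powR_ge0.
    - by rewrite !mulr_ge0 ?powR_ge0 ?(ltW C10).
    - by under eq_bigr do rewrite -powRrM -/q.
  apply: ge0_ler_powR; rewrite ?nnegrE ?(ltW pc)//.
  - by apply: sumr_ge0 => t _; exact: powR_ge0.
  - by rewrite !mulr_ge0 ?invr_ge0 ?exprn_ge0 ?(ltW C20) ?(ltW M1) ?(ltW N1).
  - by under eq_bigr do rewrite -powRrM -/s.
have H := HY M g M0; rewrite -/q in H.
have HM : \sum_(0 <= y < M) M%:R `^ q * `|cyclic_avg k.+1 N M F y| `^ q <=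
    C1 * M%:R * (\sum_(0 <= t < M) normc (g t) `^ p) `^ (q - 1).
  apply: le_trans H; apply: ler_sum => y _.
  rewrite -powRM// -{1}(ger0_norm (ltW M1)) -normrM -normc_real.
  have := cyclic_avg_fourier k.+1 N y F M0; rewrite /real_complex_def => ->.
  by [].
rewrite -mulr_sumr in HM.
have Mq : 0 < M%:R `^ q :> R by exact: powR_gt0.
rewrite -(ler_pM2l Mq); apply: le_trans HM _.
have q1 : 0 <= q - 1 by rewrite qE invr_ge0 ltW.
apply: (@le_trans _ _ (C1 * M%:R * ((C1 * M%:R * S `^ (q - 1)) `^ (p - 1) *
    (C2 * (M%:R / N%:R ^+ k.+1)) `^ (2 - p)) `^ (q - 1))).
  apply: ler_wpM2l; first by rewrite mulr_ge0 ?(ltW C10) ?(ltW M1).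
  apply: ge0_ler_powR; rewrite ?nnegrE ?mulr_ge0 ?powR_ge0//.
  by apply: sumr_ge0 => t _; exact: powR_ge0.
have Nk : (0 : R) < N%:R ^+ k.+1 by rewrite exprn_gt0.
have Sq : (S `^ (q - 1)) `^ (p - 1) = S by rewrite -powRrM qE mulVf ?gt_eqF// powRr1.
(* The powers [p - 1] and [2 - p] of [M] add up to 1. After the power [q - 1] and with the [M] in
   front this gives [M^q], which cancels the factor on the left. *)
have E1 : (C1 * M%:R * S `^ (q - 1)) `^ (p - 1) * (C2 * (M%:R / N%:R ^+ k.+1)) `^ (2 - p) =
   (C1 `^ (p - 1) * C2 `^ (2 - p)) * (M%:R * (S * N%:R `^ (- (k.+1%:R * (2 - p))))).
  rewrite !powRM ?invr_ge0 ?mulr_ge0 ?powR_ge0 ?(ltW C10) ?(ltW C20) ?(ltW M1) ?(ltW Nk)//.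
  rewrite Sq powRVl// -powR_mulrn ?(ltW N1)// -powRrM -powRN.
  have ME : M%:R `^ (p - 1) * M%:R `^ (2 - p) = M%:R :> R.
    by rewrite -powRD_gt0// [_ + _](_ : _ = 1) ?powRr1 ?(ltW M1)//; lra.
  rewrite -[in RHS]ME; ring.
rewrite E1.
have c0 : 0 <= C1 `^ (p - 1) * C2 `^ (2 - p) by rewrite mulr_ge0 ?powR_ge0.
rewrite (powRM _ c0) ?mulr_ge0 ?powR_ge0//.
rewrite (powRM _ (ltW M1)) ?mulr_ge0 ?powR_ge0//.
rewrite (powRM _ S0) ?powR_ge0// -powRrM.
have -> : - (k.+1%:R * (2 - p)) * (q - 1) = - (k.+1%:R * ((2 - p) / (p - 1))).
  by rewrite qE; ring.
have -> : M%:R `^ q = M%:R * M%:R `^ (q - 1) :> R.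
  by rewrite mulr_powRB1// ltW.
rewrite le_eqVlt; apply/orP; left; apply/eqP; ring.
Qed.

(** Convexity of the square, and invariance of the sum under translation modulo [M]. *)
Lemma cyclic_avg_le2 (d N M : nat) F : (0 < N)%N -> (0 < M)%N ->
  \sum_(0 <= y < M) cyclic_avg d N M F y ^+ 2 <= \sum_(0 <= y < M) F y ^+ 2.
Proof.
move=> N0 M0; have N1 : (0 : R) < N%:R by rewrite ltr0n.
apply: (@le_trans _ _ (\sum_(0 <= y < M) N%:R^-1 *
    \sum_(1 <= k < N.+1) F ((y + k ^ d) %% M)%N ^+ 2)).
  by apply: ler_sum => y _; apply: sqr_mean_le; rewrite // size_iota subn1.
rewrite -mulr_sumr exchange_big/=.
have shift (c : nat) : \sum_(0 <= y < M) F ((y + c) %% M)%N ^+ 2 = \sum_(0 <= y < M) F y ^+ 2.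
  rewrite !big_mkord.
  pose h (i : 'I_M) : 'I_M := Ordinal (ltn_pmod (i + c) M0).
  rewrite [RHS](reindex_inj (h := h))//= => i j /(congr1 val)/= /eqP.
  by rewrite eqn_modDr !modn_small// => /eqP/val_inj.
under eq_bigr do rewrite shift.
by rewrite sumr_const_nat subn1/= -(mulr_natl (\sum_(0 <= y < M) _)) mulrA mulVf ?gt_eqF// mul1r.
Qed.

End CyclicFourier.

(** * Transfer to the integers *)

Section Transfer.
Variable R : realType.
Implicit Types (p : R) (f : int -> R).

(** With [W] the moment exponent, the threshold is [2 - 2 / (1 + W)]; being above it means
    [(2 - p)(1 + W) < 2], that is, [W (2 - p) < p]. *)
Lemma ptilde_moment_exponent (k : nat) p : ptilde k.+1 < p ->
  1 < p /\ (k.+1 * (2 ^ k).+1)%N%:R * (2 - p) <= p.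
Proof.
rewrite natrM -[(2 ^ k).+1%:R]natr1 natrX; set W := k.+1%:R * _.
have W1 : 1 <= W.
  rewrite mulr_ege1 ?ler1n// lerDr exprn_ge0//.
have -> : ptilde k.+1 = 2 - 2 / (1 + W) :> R.
  have A : 2 + k.+1%:R * (2 ^+ k.+1 + 2) = 2 * (1 + W) :> R by rewrite /W exprS; ring.
  by rewrite /ptilde A; field; rewrite gt_eqF//; lra.
have W0 : 0 < 1 + W by lra.
move=> h; have h2 : (2 - p) * (1 + W) < 2.
  have : 2 - p < 2 / (1 + W) by lra.
  by rewrite ltr_pdivlMr.
by split; nra.
Qed.

(** Adds the endpoint [p = 2], where [2 - p = 0] rules out the Hoelder step but the power of [N] is
    trivial and contraction on [l^2] suffices. *)
Lemma cyclic_avg_improving (k : nat) p : (1 < k)%N -> ptilde k.+1 < p -> p <= 2 ->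
  exists2 C : R, 0 < C & forall (N M : nat) (F : nat -> R), (0 < N)%N ->
    ((k.+1)`! * N ^ k.+1 <= M)%N ->
    \sum_(0 <= y < M) `|cyclic_avg k.+1 N M F y| `^ (p / (p - 1)) <=
    C * N%:R `^ (- (k.+1%:R * ((2 - p) / (p - 1)))) *
    (\sum_(0 <= y < M) `|F y| `^ p) `^ (p / (p - 1) - 1).
Proof.
move=> k1 /ptilde_moment_exponent[p1 hs]; rewrite le_eqVlt => /predU1P[pE|p2]; last first.
  by apply: cyclic_avg_le => //; rewrite p1.
exists 1 => // N M F N0 NM.
have M0 : (0 < M)%N by apply: leq_trans NM; rewrite muln_gt0 fact_gt0 expn_gt0 N0.
have -> : p / (p - 1) = 2%:R by rewrite pE; field; lra.
have -> : 2%:R - 1 = 1 :> R by lra.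
rewrite pE subrr mul0r mulr0 oppr0 powRr0 !mul1r.
rewrite powRr1; last by apply: sumr_ge0 => i _; exact: powR_ge0.
have sqE (x : R) : `|x| `^ 2 = x ^+ 2 by rewrite powR_mulrn// -normrX ger0_norm ?sqr_ge0.
under eq_bigr do rewrite sqE.
under [leRHS]eq_bigr do rewrite sqE.
exact: cyclic_avg_le2.
Qed.

Definition window (K n : nat) : seq int := [seq y%:Z - K%:Z | y <- iota 0 n].

Lemma window_uniq K n : uniq (window K n).
Proof. by rewrite map_inj_uniq ?iota_uniq// => x y /addIr []. Qed.

Lemma mem_window (K : nat) (x : int) : (absz x <= K)%N -> x \in window K K.*2.+1.
Proof.
move=> xK; apply/mapP; exists (absz (x + K%:Z)); last by lia.
by rewrite mem_iota; lia.
Qed.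

Lemma sum_windowE (K n : nat) (a : int -> R) :
  (\sum_(x \in [set` window K n]) (a x)%:E)%E = (\sum_(0 <= y < n) a (y%:Z - K%:Z))%:E.
Proof.
rewrite -fsbig_seq ?window_uniq//= sumEFin /window big_map.
by rewrite /index_iota subn0.
Qed.

Lemma sum_window_le_esum (K n : nat) (a : int -> R) : (forall x, 0 <= a x) ->
  ((\sum_(0 <= y < n) a (y%:Z - K%:Z))%:E <= \esum_(x in [set: int]) (a x)%:E)%E.
Proof.
move=> a0; apply: esum_ge; exists [set` window K n]%classic; last by rewrite sum_windowE.
by split => //; exact: finite_seq.
Qed.

Lemma esum_int_le (a : int -> R) (B : \bar R) : (forall x, 0 <= a x) ->
  (forall K : nat, ((\sum_(0 <= y < K.*2.+1) a (y%:Z - K%:Z))%:E <= B)%E) ->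
  (\esum_(x in [set: int]) (a x)%:E <= B)%E.
Proof.
move=> a0 H; apply: ge_ereal_sup => _ [A [Afin _] <-].
have /finite_seqP[s As] := Afin.
pose K := \max_(x <- s) `|x|%N.
apply: le_trans (H K); rewrite -sum_windowE.
apply: lee_fsum_nneg_subset => //.
  exact: finite_seq.
  move=> x; rewrite !inE As /= => xs.
  by apply: mem_window; exact: leq_bigmax_seq.
by move=> x _; rewrite lee_fin.
Qed.

Lemma cyclic_avg_window (d N M K y : nat) f : (y + N ^ d < M)%N ->
  cyclic_avg d N M (fun z => f (z%:Z - K%:Z)) y = avg_op d N f (y%:Z - K%:Z).
Proof.
move=> yM; congr (_ * _); apply: eq_big_nat => j /andP[_ jN].
rewrite modn_small; last first.
  apply: leq_ltn_trans yM; rewrite leq_add2l.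
  by have [->|d0] := posnP d; rewrite ?expn0// leq_exp2r.
by congr f; rewrite PoszD -[Posz (j ^ d)]natz natrX natz addrAC.
Qed.

(** The sum over the integers is a supremum over windows. On each window the average agrees with a
    cyclic one, whose constant depends neither on the window nor on [M]. *)
Lemma esum_avg_op_le (k : nat) p : (1 < k)%N -> ptilde k.+1 < p -> p <= 2 ->
  exists2 C : R, 0 < C & forall (N : nat) f (E : R), (0 < N)%N ->
    (\esum_(x in [set: int]) ((`|f x| `^ p)%:E))%E = E%:E ->
    (\esum_(x in [set: int]) ((`|avg_op k.+1 N f x| `^ conj_exp p)%:E) <=
    (C * N%:R `^ (- (k.+1%:R * ((2 - p) / (p - 1)))) * E `^ (conj_exp p - 1))%:E)%E.
Proof.
move=> k1 pt p2; have [p1 _] := ptilde_moment_exponent pt.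
have [C C0 H] := cyclic_avg_improving k1 pt p2; exists C => // N f E N0 fE.
have q1 : 0 <= p / (p - 1) - 1.
  have -> : p / (p - 1) - 1 = (p - 1)^-1 by field; lra.
  by rewrite invr_ge0; lra.
apply: esum_int_le => [x|K]; first exact: powR_ge0.
rewrite lee_fin.
(* The summands provide the output window, room for the largest shift without wrap-around, and the
   lower bound on [M] required by the cyclic estimate. *)
pose M := (K.*2.+1 + N ^ k.+1 + (k.+1)`! * N ^ k.+1)%N.
pose F (z : nat) := f (z%:Z - K%:Z).
apply: (@le_trans _ _ (\sum_(0 <= y < M) `|cyclic_avg k.+1 N M F y| `^ conj_exp p)).
  apply: (@le_trans _ _ (\sum_(0 <= y < K.*2.+1) `|cyclic_avg k.+1 N M F y| `^ conj_exp p)).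
    apply: ler_sum_nat => y /andP[_ yK]; rewrite cyclic_avg_window//.
    have : (0 < (k.+1)`! * N ^ k.+1)%N by rewrite muln_gt0 fact_gt0 expn_gt0 N0.
    by rewrite /M; move: (_ * _)%N => z; lia.
  apply: ler_sum_nat_widen => [|i]; last exact: powR_ge0.
  by rewrite /M -addnA leq_addr.
apply: le_trans (H N M F N0 (leq_addl _ _)) _.
apply: ler_wpM2l; first by rewrite mulr_ge0 ?powR_ge0 ?(ltW C0).
have S0 : 0 <= \sum_(0 <= y < M) `|F y| `^ p by apply: sumr_ge0 => i _; exact: powR_ge0.
have SE : \sum_(0 <= y < M) `|F y| `^ p <= E.
  rewrite -lee_fin -fE; apply: (@sum_window_le_esum K M (fun x => `|f x| `^ p)) => x.
  exact: powR_ge0.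
by apply: ge0_ler_powR => //; rewrite nnegrE// (le_trans S0).
Qed.

End Transfer.

Theorem theorem3 (R : realType) (d : nat) (p : R) :
  (2 < d)%N -> ptilde d < p -> p <= 2 ->
  exists C : R, 0 < C /\
    forall (N : nat) (f : int -> R), (0 < N)%N ->
      (lpnorm (conj_exp p) (avg_op d N f)
        <= (C * N%:R `^ (d%:R / conj_exp p - d%:R / p))%:E * lpnorm p f)%E.
Proof.
case: d => // k k1 pt p2; have [p1 _] := ptilde_moment_exponent pt.
have [C C0 H] := esum_avg_op_le (k1 : (1 < k)%N) pt p2.
have p0 : 0 < p by lra.
have pm : 0 < p - 1 by lra.
have q0 : 0 < conj_exp p by rewrite divr_gt0.
exists (C `^ (conj_exp p)^-1); split; first exact: powR_gt0.
move=> N f N0; have N1 : (0 : R) < N%:R by rewrite ltr0n.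
rewrite /lpnorm; set Sp := (\esum_(x in _) ((`|f x| `^ p)%:E))%E.
have Sp0 : (0 <= Sp)%E by apply: esum_ge0 => x _; rewrite lee_fin powR_ge0.
have K0 : 0 < C `^ (conj_exp p)^-1 * N%:R `^ (k.+1%:R / conj_exp p - k.+1%:R / p).
  by rewrite mulr_gt0 ?powR_gt0.
(* If [f] is not in [l^p], the right side is [+oo] because its constant factor is positive. *)
case SE : Sp Sp0 => [E| |]//; last first.
  by move=> _; rewrite poweRyr ?invr_eq0 ?gt_eqF// gt0_muley ?leey// lte_fin.
rewrite lee_fin => E0.
have h := H N f E N0 SE.
apply: le_trans (_ : poweR _ (conj_exp p)^-1 <= _)%E.
  apply: (gt0_ler_poweR _ _ _ h); first by rewrite invr_ge0 ltW.
    by rewrite in_itv/= leey andbT; apply: esum_ge0 => x _; rewrite lee_fin powR_ge0.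
  by rewrite in_itv/= leey andbT lee_fin !mulr_ge0 ?powR_ge0 ?(ltW C0).
rewrite !poweR_EFin -EFinM lee_fin.
rewrite !powRM ?mulr_ge0 ?powR_ge0 ?(ltW C0)// -!powRrM.
(* Both sides equal [- d (2 - p) / p]. *)
have -> : - (k.+1%:R * ((2 - p) / (p - 1))) / conj_exp p =
    k.+1%:R / conj_exp p - k.+1%:R / p.
  by rewrite /conj_exp; field; rewrite !gt_eqF.
have -> : (conj_exp p - 1) / conj_exp p = p^-1.
  by rewrite /conj_exp; field; rewrite !gt_eqF.
by [].
Qed.
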